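(* For every finitely generated unital $\ell$-group $(G,u)$ there is a stellar sequence $\mathcal W$ such that $\mathcal G(\mathcal W)\cong(G,u)$ (as unital $\ell$-groups).
   Context: Unital $\ell$-groups. A unital $\ell$-group $(G,u)$ is an abelian group $G$ with a lattice structure such that $x+(y\vee z)=(x+y)\vee(x+z)$ for all $x,y,z$, together with a distinguished order-unit $u$, i.e. for every $g\in G$ there is an integer $k\ge 0$ with $g\le ku$. Unital $\ell$-homomorphisms are group homomorphisms preserving $\vee,\wedge$ and the order-unit; $\cong$ means there is a bijective one. An $\ell$-ideal is the kernel of a unital $\ell$-homomorphism. $\mathcal M([0,1]^n)$ is the unital $\ell$-group (pointwise operations, order-unit the constant $1$) of continuous piecewise linear functions $f\colon[0,1]^n\to\mathbb R$ with finitely many pieces, each piece affine with integer coefficients. For $f\in\mathcal M([0,1]^n)$ let $\mathcal Z(f)=f^{-1}(0)$. Regular complexes. For a rational point $y\in\mathbb R^n$, $\mathrm{den}(y)$ is the least common denominator of its coordinates and $\tilde y=\mathrm{den}(y)(y,1)\in\mathbb Z^{n+1}$. A simplex $\mathrm{conv}(v_0,\dots,v_k)\subseteq\mathbb R^n$ with rational vertices is regular if $\{\tilde v_0,\dots,\tilde v_k\}$ is part of a basis of the free abelian group $\mathbb Z^{n+1}$. A regular complex $\Delta$ is a finite (geometric) simplicial complex all of whose simplexes are rational and regular; its support $|\Delta|$ is the union of its simplexes. The Farey mediant of a regular $1$-simplex $\mathrm{conv}(v_0,v_1)$ is the rational point $v$ of it with $\tilde v=\tilde v_0+\tilde v_1$.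 The blow-up $\Delta_{(p)}$ of $\Delta$ at $p\in|\Delta|$ is obtained by replacing every $T\in\Delta$ containing $p$ by all simplexes $\mathrm{conv}(F\cup\{p\})$, with $F$ a face of $T$ not containing $p$. Weighted complexes and stellar sequences. A weighted abstract simplicial complex is a triple $W=(\mathcal V,\Sigma,\omega)$ where $\mathcal V$ is a finite nonempty set (of vertices), $\Sigma$ is a collection of subsets of $\mathcal V$ with union $\mathcal V$ and closed under taking subsets, and $\omega\colon\mathcal V\to\{1,2,3,\dots\}$. For a two-element set $\{v,w\}\in\Sigma$ and $a\notin\mathcal V$, the binary subdivision $(\{v,w\},a)W$ is obtained by adding $a$ to the vertex set, replacing every set $\{v,w,u_1,\dots,u_t\}\in\Sigma$ by the two sets $\{v,a,u_1,\dots,u_t\}$, $\{a,w,u_1,\dots,u_t\}$ and their faces, and extending the weight by $\omega(a)=\omega(v)+\omega(w)$. A sequence $\mathcal W=(W_0,W_1,\dots)$ of weighted abstract simplicial complexes is stellar if each $W_{j+1}$ is obtained from $W_j$ either by deleting a maximal set of $W_j$ (if this set is a singleton $\{v\}$, the vertex $v$ is removed too), or by a binary subdivision, or else $W_{j+1}=W_j$. Construction of $\mathcal G(\mathcal W)$. A $\nabla$-realization of $W=(\mathcal V,\Sigma,\omega)$, for $\nabla$ a regular complex, is a bijection $\iota$ from $\mathcal V$ onto the set of vertices of $\nabla$ such that $\mathrm{den}(\iota(v))=\omega(v)$ for all $v$, and $\{w_1,\dots,w_k\}\in\Sigma$ iff $\mathrm{conv}(\iota(w_1),\dots,\iota(w_k))\in\nabla$.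 Given a stellar sequence $\mathcal W$ and a $\Delta_0$-realization $\iota_0$ of $W_0$ with $|\Delta_0|\subseteq[0,1]^n$, define inductively $\Delta_j$-realizations $\iota_j$ of $W_j$: if $W_{j+1}$ is obtained by deleting the maximal set $M$, then $\Delta_{j+1}$ is $\Delta_j$ with the simplex $\mathrm{conv}(\iota_j(M))$ deleted and $\iota_{j+1}$ is the restriction of $\iota_j$; if $W_{j+1}=(\{a,b\},c)W_j$, then $\Delta_{j+1}=(\Delta_j)_{(e)}$ with $e$ the Farey mediant of $\mathrm{conv}(\iota_j(a),\iota_j(b))$, and $\iota_{j+1}=\iota_j\cup\{(c,e)\}$; if $W_{j+1}=W_j$ then $\Delta_{j+1}=\Delta_j$, $\iota_{j+1}=\iota_j$. The $\Delta_0$-orbit is $\mathcal O(\mathcal W,\Delta_0)=\{|\Delta_0|\supseteq|\Delta_1|\supseteq\cdots\}$; $\mathcal I(\mathcal W,\Delta_0)=\{f\in\mathcal M([0,1]^n)\mid \mathcal Z(f)\supseteq|\Delta_j|\text{ for some }j\}$, an $\ell$-ideal; and $\mathcal G(\mathcal W,\Delta_0)=\mathcal M([0,1]^n)/\mathcal I(\mathcal W,\Delta_0)$. The canonical realization of $W_0$ with vertices $v_1,\dots,v_n$ sends $v_i$ to $e_i/\omega(v_i)$ ($e_i$ the standard basis vectors of $\mathbb R^n$), and its regular complex $\Delta_{W_0}$ consists of the simplexes spanned by the images of the sets in $\Sigma$. $\mathcal O(\mathcal W),\mathcal I(\mathcal W),\mathcal G(\mathcal W)$ denote $\mathcal O(\mathcal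 W,\Delta_{W_0}),\mathcal I(\mathcal W,\Delta_{W_0}),\mathcal G(\mathcal W,\Delta_{W_0})$.
   Formalization: Only W_0 must have a nonempty vertex set; later complexes may become empty by deleting the last vertex. Otherwise the trivial unital ℓ-group {0} would be a counterexample; for nontrivial G all W_j are automatically nonempty. *)

(* Defs.v *)
From HB Require Import structures.
From mathcomp Require Import all_boot all_order all_algebra finmap.
From mathcomp Require Import generic_quotient ring_quotient.
From mathcomp Require Import all_classical all_reals topology normedtype.

Set Implicit Arguments.
Unset Strict Implicit.
Unset Printing Implicit Defensive.

Import Order.TTheory GRing.Theory Num.Theory.
Import numFieldNormedType.Exports.

Local Open Scope quotient_scope.
Local Open Scope classical_set_scope.
Local Open Scope ring_scope.

(* [Order.Lattice] cannot be joined with [GRing.Zmodule] in a new structure once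
   [realDomainType] has been declared, so the lattice structure is given by its
   operations and axioms. *)
HB.mixin Record Zmodule_isLGroup V of GRing.Zmodule V := {
  ljoin : V -> V -> V;
  lmeet : V -> V -> V;
  ljoinC : commutative ljoin;
  lmeetC : commutative lmeet;
  ljoinA : associative ljoin;
  lmeetA : associative lmeet;
  ljoinKI : forall y x : V, lmeet x (ljoin x y) = x;
  lmeetKU : forall y x : V, ljoin x (lmeet x y) = x;
  addr_ljoin : forall x y z : V, x + ljoin y z = ljoin (x + y) (x + z)
}.

#[short(type="lGroupType")]
HB.structure Definition LGroup := {V of GRing.Zmodule V & Zmodule_isLGroup V}.

Definition lle (V : lGroupType) (x y : V) : Prop := ljoin x y = y.

HB.mixin Record LGroup_isUnital V of LGroup V := {
  ounit : V;
  ounitP : forall x : V, exists k : nat, lle x (ounit *+ k)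
}.

#[short(type="unitalLGroupType")]
HB.structure Definition UnitalLGroup := {V of LGroup V & LGroup_isUnital V}.

Arguments ounit {s}.

Definition unital_lsubgroup (G : unitalLGroupType) (H : set G) : Prop :=
  [/\ H ounit,
      forall x y, H x -> H y -> H (x - y),
      forall x y, H x -> H y -> H (ljoin x y)
    & forall x y, H x -> H y -> H (lmeet x y)].

Definition finitely_generated (G : unitalLGroupType) : Prop :=
  exists s : seq G, forall H : set G,
    unital_lsubgroup H -> (forall x, x \in s -> H x) -> forall x, H x.

Definition unital_lhom (G H : unitalLGroupType) (phi : {additive G -> H}) : Prop :=
  [/\ forall x y, phi (ljoin x y) = ljoin (phi x) (phi y),
      forall x y, phi (lmeet x y) = lmeet (phi x) (phi y)
    & phi ounit = ounit].

Definition unital_liso (G H : unitalLGroupType) : Prop :=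
  exists phi : {additive G -> H}, unital_lhom phi /\ bijective phi.

Section LGroupTheory.
Variable V : lGroupType.
Implicit Types x y z : V.

Lemma ljoinxx x : ljoin x x = x.
Proof. by rewrite -{2}(ljoinKI x x) lmeetKU. Qed.

Lemma lle_meetP x y : lle x y <-> lmeet x y = x.
Proof.
by rewrite /lle; split=> <-; [rewrite ljoinKI | rewrite ljoinC lmeetC lmeetKU].
Qed.

Lemma lle_anti x y : lle x y -> lle y x -> x = y.
Proof. by move=> xy yx; rewrite -[LHS]yx -[RHS]xy ljoinC. Qed.

Lemma lle_joinl x y : lle x (ljoin x y).
Proof. by rewrite /lle ljoinA ljoinxx. Qed.

Lemma lle_joinr x y : lle y (ljoin x y).
Proof. by rewrite ljoinC; apply: lle_joinl. Qed.

Lemma lle_meetl x y : lle (lmeet x y) x.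
Proof. by rewrite /lle ljoinC lmeetKU. Qed.

Lemma lle_meetr x y : lle (lmeet x y) y.
Proof. by rewrite lmeetC; apply: lle_meetl. Qed.

Lemma lle_join x y z : lle x z -> lle y z -> lle (ljoin x y) z.
Proof. by rewrite /lle => xz yz; rewrite -ljoinA yz. Qed.

Lemma lle_meet x y z : lle z x -> lle z y -> lle z (lmeet x y).
Proof. by rewrite !lle_meetP => xz yz; rewrite lmeetA xz. Qed.

Lemma lleN x y : lle x y -> lle (- y) (- x).
Proof.
rewrite /lle => xy; have := congr1 (+%R (- x - y)) xy.
by rewrite addr_ljoin addrNK addrAC addNr add0r => ->.
Qed.

Lemma lmeetE x y : lmeet x y = - ljoin (- x) (- y).
Proof.
apply: lle_anti.
  rewrite -[lmeet x y]opprK; apply: lleN.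
  by apply: lle_join; apply: lleN; [apply: lle_meetl | apply: lle_meetr].
apply: lle_meet; [rewrite -{2}[x]opprK | rewrite -{2}[y]opprK]; apply: lleN.
  exact: lle_joinl.
exact: lle_joinr.
Qed.

End LGroupTheory.

(* The l-ideals are the kernels of the l-homomorphisms, i.e. the subgroups whose
   associated congruence is compatible with the join (hence with the meet, by
   [lmeetE]). *)
Record lIdeal (V : lGroupType) := LIdeal {
  lideal_pred :> {pred V};
  lideal_zmod : zmod_closed lideal_pred;
  lideal_join : forall x y z : V, x - y \in lideal_pred ->
    ljoin x z - ljoin y z \in lideal_pred
}.

HB.instance Definition _ (V : lGroupType) (I : lIdeal V) :=
  GRing.isZmodClosed.Build V (lideal_pred I) (lideal_zmod I).

Definition lquot (V : lGroupType) (I : lIdeal V) : Type :=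
  Quotient.quot (lideal_pred I).

Section LQuot.
Variables (V : lGroupType) (I : lIdeal V).
Local Notation Q := (lquot I).
Local Notation pr := (\pi_(Quotient.quot (lideal_pred I))).

HB.instance Definition _ := GRing.Zmodule.on Q.

Definition lquot_join (x y : Q) : Q := pr (ljoin (repr x) (repr y)).
Definition lquot_meet (x y : Q) : Q := pr (lmeet (repr x) (repr y)).

Lemma lquot_eqP (x y : V) : reflect (pr x = pr y) (x - y \in lideal_pred I).
Proof. by rewrite Quotient.idealrBE; apply: eqP. Qed.

Lemma lquot_repr (x : V) : repr (pr x) - x \in lideal_pred I.
Proof. by apply/lquot_eqP; rewrite reprK. Qed.

Lemma lquot_pi_join (x y : V) : lquot_join (pr x) (pr y) = pr (ljoin x y).
Proof.
transitivity (pr (ljoin x (repr (pr y)))); apply/lquot_eqP.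
  exact/lideal_join/lquot_repr.
rewrite ![ljoin x _]ljoinC; exact/lideal_join/lquot_repr.
Qed.

Lemma lquot_pi_meet (x y : V) : lquot_meet (pr x) (pr y) = pr (lmeet x y).
Proof.
rewrite /lquot_meet !lmeetE; have piN z : pr (- z) = - pr z by exact: raddfN.
rewrite (piN (ljoin _ _)) (piN (ljoin (- x) _)); congr (- _).
by rewrite -!lquot_pi_join !piN !reprK.
Qed.

Lemma lquot_ind (P : Q -> Prop) : (forall x, P (pr x)) -> forall x, P x.
Proof. by move=> H x; rewrite -[x]reprK. Qed.

Lemma lquot_joinC : commutative lquot_join.
Proof.
by elim/lquot_ind=> x; elim/lquot_ind=> y; rewrite !lquot_pi_join ljoinC.
Qed.

Lemma lquot_meetC : commutative lquot_meet.
Proof.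
by elim/lquot_ind=> x; elim/lquot_ind=> y; rewrite !lquot_pi_meet lmeetC.
Qed.

Lemma lquot_joinA : associative lquot_join.
Proof.
elim/lquot_ind=> x; elim/lquot_ind=> y; elim/lquot_ind=> z.
by rewrite !lquot_pi_join ljoinA.
Qed.

Lemma lquot_meetA : associative lquot_meet.
Proof.
elim/lquot_ind=> x; elim/lquot_ind=> y; elim/lquot_ind=> z.
by rewrite !lquot_pi_meet lmeetA.
Qed.

Lemma lquot_joinKI (y x : Q) : lquot_meet x (lquot_join x y) = x.
Proof.
elim/lquot_ind: x => x; elim/lquot_ind: y => y.
by rewrite lquot_pi_join lquot_pi_meet ljoinKI.
Qed.

Lemma lquot_meetKU (y x : Q) : lquot_join x (lquot_meet x y) = x.
Proof.
elim/lquot_ind: x => x; elim/lquot_ind: y => y.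
by rewrite lquot_pi_meet lquot_pi_join lmeetKU.
Qed.

Lemma lquot_addr_join (x y z : Q) :
  x + lquot_join y z = lquot_join (x + y) (x + z).
Proof.
elim/lquot_ind: x => x; elim/lquot_ind: y => y; elim/lquot_ind: z => z.
have piD u v : pr u + pr v = pr (u + v) :> Q by rewrite -[LHS]raddfD.
by rewrite lquot_pi_join !piD lquot_pi_join addr_ljoin.
Qed.

HB.instance Definition _ := Zmodule_isLGroup.Build Q
  lquot_joinC lquot_meetC lquot_joinA lquot_meetA lquot_joinKI lquot_meetKU
  lquot_addr_join.

End LQuot.

Section UnitalLQuot.
Variables (V : unitalLGroupType) (I : lIdeal V).

Lemma lquot_ounitP (x : lquot I) :
  exists k, lle x ((\pi_(Quotient.quot (lideal_pred I)) ounit : lquot I) *+ k).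
Proof.
elim/lquot_ind: x => x; have [k xk] := ounitP x; exists k.
set q := (X in X *+ k).
have -> : q *+ k = \pi_(Quotient.quot (lideal_pred I)) (ounit *+ k).
  by rewrite [RHS]raddfMn.
by rewrite /lle [LHS]lquot_pi_join xk.
Qed.

HB.instance Definition _ := LGroup_isUnital.Build (lquot I) lquot_ounitP.

End UnitalLQuot.

Section McNaughton.
Variables (R : realType) (n : nat).

Definition cube : set 'rV[R]_n := [set x | forall i, 0 <= x 0 i <= 1].

Definition affineZ (l : 'rV[int]_n * int) (x : 'rV[R]_n) : R :=
  \sum_i (l.1 0 i)%:~R * x 0 i + l.2%:~R.

(* [cube] is used here as a subtype of ['rV[R]_n], with the subspace topology. *)
Definition piecewise_linearZ (f : cube -> R) : Prop :=
  continuous f /\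
  exists s : seq ('rV[int]_n * int),
    forall x : cube, exists2 l, l \in s & f x = affineZ l (val x).

Definition plZ_pred : {pred cube -> R} := fun f => `[< piecewise_linearZ f >].

Record plZ := PlZ { plZ_fun :> cube -> R; plZ_subproof : plZ_fun \in plZ_pred }.

HB.instance Definition _ := [isSub for plZ_fun].
HB.instance Definition _ := [Choice of plZ by <:].

Lemma plZP (f : plZ) : piecewise_linearZ f.
Proof. exact: (asboolW (plZ_subproof f)). Qed.

Lemma plZ_ext (f g : plZ) : (forall x, f x = g x) -> f = g.
Proof. by move=> fg; apply/val_inj/funext. Qed.

Lemma plZ_cst (c : int) : piecewise_linearZ (fun=> c%:~R).
Proof.
split; first exact: cst_continuous.
exists [:: (0, c)] => x; exists (0, c); first exact: mem_head.
by rewrite /affineZ big1 ?add0r// => i _; rewrite mxE mul0r.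
Qed.

Lemma plZ_opp f : piecewise_linearZ f -> piecewise_linearZ (- f).
Proof.
move=> [cf [s fs]]; split; first by move=> x; apply: continuousN; apply: cf.
exists [seq (- l.1, - l.2) | l <- s] => x; have [l ls fx] := fs x.
exists (- l.1, - l.2); first exact: map_f.
rewrite /affineZ /= mulrNz opprfctE fx /affineZ opprD -sumrN; congr (_ + _).
by apply: eq_bigr => i _; rewrite mxE mulrNz mulNr.
Qed.

Lemma plZ_add f g :
  piecewise_linearZ f -> piecewise_linearZ g -> piecewise_linearZ (f + g).
Proof.
move=> [cf [s fs]] [cg [t gt]]; split.
  by move=> x; apply: continuousD; [apply: cf | apply: cg].
exists [seq (l.1 + m.1, l.2 + m.2) | l <- s, m <- t] => x.
have [l ls fx] := fs x; have [m mt gx] := gt x.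
exists (l.1 + m.1, l.2 + m.2); first exact: (allpairs_f (fun l m => (l.1 + m.1, l.2 + m.2))).
rewrite /affineZ /= addrfctE fx gx /affineZ intrD addrACA -big_split /=.
by congr (_ + _); apply: eq_bigr => i _; rewrite mxE intrD mulrDl.
Qed.

Lemma plZ_max f g : piecewise_linearZ f -> piecewise_linearZ g ->
  piecewise_linearZ (fun x => Num.max (f x) (g x)).
Proof.
move=> [cf [s fs]] [cg [t gt]]; split.
  by move=> x; apply: continuous_max; [apply: cf | apply: cg].
exists (s ++ t) => x; have [l ls fx] := fs x; have [m mt gx] := gt x.
by case: leP => _; [exists m | exists l]; rewrite // mem_cat ?ls ?mt ?orbT.
Qed.

Lemma plZ_min f g : piecewise_linearZ f -> piecewise_linearZ g ->
  piecewise_linearZ (fun x => Num.min (f x) (g x)).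
Proof.
move=> [cf [s fs]] [cg [t gt]]; split.
  by move=> x; apply: continuous_min; [apply: cf | apply: cg].
exists (s ++ t) => x; have [l ls fx] := fs x; have [m mt gx] := gt x.
by case: leP => _; [exists l | exists m]; rewrite // mem_cat ?ls ?mt ?orbT.
Qed.

Lemma plZ_zmod_closed : zmod_closed plZ_pred.
Proof.
split=> [|f g /asboolP Pf /asboolP Pg]; apply/asboolP; first exact: plZ_cst 0.
exact/plZ_add/plZ_opp.
Qed.
HB.instance Definition _ := GRing.isZmodClosed.Build _ plZ_pred plZ_zmod_closed.
HB.instance Definition _ := [SubChoice_isSubZmodule of plZ by <:].

Definition plZ_mk f (Pf : piecewise_linearZ f) : plZ := PlZ (asboolT Pf).

Definition plZ_join (f g : plZ) : plZ := plZ_mk (plZ_max (plZP f) (plZP g)).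
Definition plZ_meet (f g : plZ) : plZ := plZ_mk (plZ_min (plZP f) (plZP g)).

Lemma plZ_joinC : commutative plZ_join.
Proof. by move=> f g; apply: plZ_ext => x /=; rewrite maxC. Qed.

Lemma plZ_meetC : commutative plZ_meet.
Proof. by move=> f g; apply: plZ_ext => x /=; rewrite minC. Qed.

Lemma plZ_joinA : associative plZ_join.
Proof. by move=> f g h; apply: plZ_ext => x /=; rewrite maxA. Qed.

Lemma plZ_meetA : associative plZ_meet.
Proof. by move=> f g h; apply: plZ_ext => x /=; rewrite minA. Qed.

Lemma plZ_joinKI (g f : plZ) : plZ_meet f (plZ_join f g) = f.
Proof. by apply: plZ_ext => x /=; apply/min_idPl; rewrite le_max lexx. Qed.

Lemma plZ_meetKU (g f : plZ) : plZ_join f (plZ_meet f g) = f.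
Proof. by apply: plZ_ext => x /=; apply/max_idPl; rewrite ge_min lexx. Qed.

Lemma plZ_addr_join (f g h : plZ) :
  f + plZ_join g h = plZ_join (f + g) (f + h).
Proof. by apply: plZ_ext => x; apply: addr_maxr. Qed.

HB.instance Definition _ := Zmodule_isLGroup.Build plZ
  plZ_joinC plZ_meetC plZ_joinA plZ_meetA plZ_joinKI plZ_meetKU plZ_addr_join.

Definition plZ_one : plZ := plZ_mk (plZ_cst 1).

Lemma affineZ_bound (l : 'rV[int]_n * int) :
  exists k : nat, forall x : 'rV[R]_n, cube x -> affineZ l x <= k%:R.
Proof.
exists (\sum_i `|l.1 0%R i| + `|l.2|)%N => x cx.
rewrite natrD natr_sum /affineZ lerD //; last first.
  by rewrite natr_absz ler_int ler_norm.
apply: ler_sum => i _; have /andP[x0 x1] := cx i.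
apply: le_trans (ler_norm _) _; rewrite normrM (ger0_norm x0) -intr_norm natr_absz.
by rewrite ler_piMr// ler0z.
Qed.

Lemma plZ_ounitP (f : plZ) : exists k, lle f (plZ_one *+ k).
Proof.
have [_ [s fs]] := plZP f.
have [k kP] : exists k : nat, forall l, l \in s ->
    forall x : 'rV[R]_n, cube x -> affineZ l x <= k%:R.
  elim: s {fs} => [|l s [k IH]]; first by exists 0%N.
  have [m mP] := affineZ_bound l; exists (maxn k m) => l'.
  rewrite inE => /predU1P[->|l's] x cx.
    by apply: le_trans (mP x cx) _; rewrite ler_nat leq_maxr.
  by apply: le_trans (IH _ l's x cx) _; rewrite ler_nat leq_maxl.
exists k; apply: plZ_ext => x.
rewrite [LHS]/(Num.max (f x) ((plZ_one *+ k) x)).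
have -> : (plZ_one *+ k) x = k%:R.
  by elim: {kP} k => // k IH; rewrite mulrS -natr1 addrC -IH.
have [l ls ->] := fs x; apply/max_idPr; exact/kP/set_valP.
Qed.

HB.instance Definition _ := LGroup_isUnital.Build plZ plZ_ounitP.

Definition zeroset (f : plZ) : set 'rV[R]_n :=
  [set val x | x in [set x : cube | f x = 0]].

End McNaughton.

Arguments cube : clear implicits.

Section RegularComplexes.
Variables (R : realType) (n : nat).
Implicit Types (F E T : {fset 'rV[rat]_n}) (D : set {fset 'rV[rat]_n}).

Definition den (y : 'rV[rat]_n) : nat := \big[lcmn/1%N]_i `|denq (y 0%R i)|%N.

Definition homog (y : 'rV[rat]_n) : 'rV[int]_(n + 1) :=
  map_mx numq ((den y)%:R *: row_mx y (const_mx 1)).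

(* A simplex with rational vertices is encoded by its set of vertices, the
   empty set being the empty face; [hull F] is the corresponding subset of R^n. *)
Definition hull F : set 'rV[R]_n :=
  [set x | exists t : 'rV[rat]_n -> R,
    [/\ forall v, v \in F -> 0 <= t v,
        \sum_(v <- F) t v = 1
      & x = \sum_(v <- F) t v *: map_mx ratr v]].

(* The bases of Z^(n+1) are the families of rows of the unimodular matrices. *)
Definition regular_simplex F : Prop :=
  exists2 B : 'M[int]_(n + 1), B \in unitmx
    & forall v, v \in F -> exists i, row i B = homog v.

Definition regular_complex D : Prop :=
  [/\ finite_set D,
      forall T, D T -> regular_simplex T,
      forall T F, D T -> (F `<=` T)%fset -> D F
    & forall S T, D S -> D T -> hull S `&` hull T = hull (S `&` T)%fset].

Definition vertices D : set 'rV[rat]_n := [set p | D [fset p]%fset].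

Definition support D : set 'rV[R]_n := \bigcup_(T in D) hull T.

Definition farey_mediant (v w e : 'rV[rat]_n) : Prop :=
  hull [fset v; w]%fset (map_mx ratr e) /\ homog e = homog v + homog w.

Definition blowup D (p : 'rV[rat]_n) : set {fset 'rV[rat]_n} :=
  [set S | D S /\ ~ hull S (map_mx ratr p)] `|`
  [set S | exists T F, [/\ D T, hull T (map_mx ratr p), (F `<=` T)%fset,
     ~ hull F (map_mx ratr p) & S = (p |` F)%fset]].

End RegularComplexes.

Arguments hull R {n} F.
Arguments support R {n} D.

Section WeightedComplexes.
Variable K : choiceType.

(* The domain of the finite map [wmap W] is the vertex set of [W]. *)
Record wcomplex := WComplex {
  wmap : {fmap K -> nat};
  faces : set {fset K}
}.

Implicit Types (W : wcomplex) (M F : {fset K}) (v w a : K).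

Definition verts W : {fset K} := domf (wmap W).

Definition weight W v : nat := odflt 0%N (wmap W).[? v]%fmap.

(* Nonemptiness of the vertex set is required separately, see [stellar]. *)
Definition is_wcomplex W : Prop :=
  [/\ forall F, faces W F -> (F `<=` verts W)%fset,
      forall v, v \in verts W -> exists2 F, faces W F & v \in F,
      forall F E, faces W F -> (E `<=` F)%fset -> faces W E
    & forall v, v \in verts W -> (0 < weight W v)%N].

Definition maximal_face W M : Prop :=
  faces W M /\ forall F, faces W F -> (M `<=` F)%fset -> F = M.

Definition delete_face W M : wcomplex :=
  WComplex (if #|` M| == 1%N then (wmap W).[\ M]%fmap else wmap W)
           (faces W `\ M).

Definition subdivisible W v w a : Prop :=
  [/\ v != w, faces W [fset v; w]%fset & a \notin verts W].

Definition subdivision W v w a : wcomplex :=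
  WComplex (wmap W).[a <- (weight W v + weight W w)%N]%fmap
    ([set F | faces W F /\ ~~ ([fset v; w] `<=` F)%fset] `|`
     [set F | exists S, [/\ faces W S, ([fset v; w] `<=` S)%fset
        & (F `<=` a |` (S `\ w))%fset \/ (F `<=` a |` (S `\ v))%fset]]).

(* Deleting the last vertex yields the complex without vertices, so only [W 0]
   is required to have vertices.  The trivial l-group arises in this way. *)
Definition stellar (W : nat -> wcomplex) : Prop :=
  [/\ verts (W 0%N) != fset0,
      forall j, is_wcomplex (W j)
    & forall j,
      [\/ exists2 M, maximal_face (W j) M & W j.+1 = delete_face (W j) M,
          exists v w a, subdivisible (W j) v w a /\
            W j.+1 = subdivision (W j) v w a
        | W j.+1 = W j]].

End WeightedComplexes.

Section Realizations.
Variables (R : realType) (K : choiceType) (n : nat).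

Definition realization (W : wcomplex K) (D : set {fset 'rV[rat]_n})
    (iota : K -> 'rV[rat]_n) : Prop :=
  [/\ regular_complex R D,
      set_bij [set` verts W] (vertices D) iota,
      forall v, v \in verts W -> den (iota v) = weight W v
    & forall F : {fset K}, (F `<=` verts W)%fset ->
        faces W F <-> D [fset iota v | v in F]%fset].

Definition realization_step (W W' : wcomplex K) (D D' : set {fset 'rV[rat]_n})
    (iota iota' : K -> 'rV[rat]_n) : Prop :=
  [\/ exists M, [/\ maximal_face W M, W' = delete_face W M,
        D' = D `\ [fset iota v | v in M]%fset
        & {in verts W', iota' =1 iota}],
      exists a b c e, [/\ subdivisible W a b c, W' = subdivision W a b c,
        farey_mediant R (iota a) (iota b) e, D' = blowup R D e
        & iota' c = e /\ {in verts W, iota' =1 iota}]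
    | [/\ W' = W, D' = D & {in verts W, iota' =1 iota}]].

(* The sequences Delta_j and iota_j; the maps iota_j only matter on the vertices
   of W_j, where they are determined by Delta_0 and iota_0. *)
Record realization_seq (W : nat -> wcomplex K) := RealizationSeq {
  rs_complex : nat -> set {fset 'rV[rat]_n};
  rs_map : nat -> K -> 'rV[rat]_n;
  rs_realization : forall j, realization (W j) (rs_complex j) (rs_map j);
  rs_cube : support R (rs_complex 0%N) `<=` cube R n;
  rs_step : forall j, realization_step (W j) (W j.+1)
    (rs_complex j) (rs_complex j.+1) (rs_map j) (rs_map j.+1)
}.

Lemma sum_fset_incl (V : zmodType) (F T : {fset 'rV[rat]_n})
    (f : 'rV[rat]_n -> V) : (F `<=` T)%fset ->
  \sum_(v <- T) (if v \in F then f v else 0) = \sum_(v <- F) f v.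
Proof.
move=> FT; rewrite -(big_fset_incl _ FT) => [|v _ /negPf ->//].
by apply: eq_big_seq => v ->.
Qed.

Lemma hull_mono (F T : {fset 'rV[rat]_n}) :
  (F `<=` T)%fset -> hull R F `<=` hull R T.
Proof.
move=> FT x [t [t0 t1 ->]]; exists (fun v => if v \in F then t v else 0).
split; first by move=> v _; case: ifP => // /t0.
  by rewrite sum_fset_incl.
rewrite -(sum_fset_incl _ FT); apply: eq_bigr => v _.
by case: ifP => //; rewrite scale0r.
Qed.

Lemma hull_cone (F T : {fset 'rV[rat]_n}) (p : 'rV[rat]_n) :
  hull R T (map_mx ratr p) -> (F `<=` T)%fset ->
  hull R (p |` F)%fset `<=` hull R T.
Proof.
move=> [s [s0 s1 ps]] FT.
have [pF|pF] := boolP (p \in F); first by rewrite mem_fset1U //; apply: hull_mono.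
move=> x [t [t0 + ->]]; rewrite !big_fsetU1 //= ps => t1.
exists (fun v => t p * s v + (if v \in F then t v else 0)); split.
- move=> v vT; rewrite addr_ge0 ?mulr_ge0 ?s0 ?t0 ?fset1U1 //.
  by case: ifP => // vF; rewrite t0 // fset1Ur.
- by rewrite big_split /= -mulr_sumr s1 mulr1 sum_fset_incl.
rewrite scaler_sumr -(sum_fset_incl _ FT) -big_split; apply: eq_bigr => v _ /=.
by rewrite scalerDl scalerA; case: ifP; rewrite ?scale0r.
Qed.

Variables (W : nat -> wcomplex K) (r : realization_seq W).

Local Notation orbit j := (support R (rs_complex r j)).

Lemma orbit_decr i j : (i <= j)%N -> orbit j `<=` orbit i.
Proof.
elim: j => [|j IH]; first by rewrite leqn0 => /eqP ->.
rewrite leq_eqVlt => /predU1P[->//|]; rewrite ltnS => /IH; apply: subset_trans.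
have [] := rs_step r j.
- by move=> [M [_ _ -> _]] x [T [DT _] Tx]; exists T.
- move=> [a [b [c [e [_ _ _ -> _]]]]] x [S /= [[DS _]|[T [F [DT Te FT _ ->]]]] Sx].
    by exists S.
  by exists T => //; apply: hull_cone Sx.
by move=> [_ -> _].
Qed.

Definition orbit_ideal_pred : {pred plZ R n} :=
  fun f => `[< exists j, orbit j `<=` zeroset f >].

Lemma zerosetP (f : plZ R n) (x : cube R n) : zeroset f (val x) <-> f x = 0.
Proof. by split=> [[y fy /val_inj <-]|fx] //; exists x. Qed.

Lemma orbit_idealP (f : plZ R n) : f \in orbit_ideal_pred <->
  exists j, forall x : cube R n, orbit j (val x) -> f x = 0.
Proof.
split=> [/asboolP[j fj]|[j fj]].
  by exists j => x /fj /zerosetP.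
apply/asboolP; exists j => x ox.
have cx : x \in cube R n.
  exact/mem_set/(rs_cube (orbit_decr (leq0n j) ox)).
by exists (exist _ x cx) => //=; apply: fj.
Qed.

Lemma orbit_ideal_zmod : zmod_closed orbit_ideal_pred.
Proof.
split=> [|f g /orbit_idealP[i fi] /orbit_idealP[j gj]]; apply/orbit_idealP.
  by exists 0%N.
exists (maxn i j) => x ox; rewrite [LHS]/(f x - g x).
rewrite (fi x (orbit_decr (leq_maxl i j) ox))
  (gj x (orbit_decr (leq_maxr i j) ox)); exact: subrr.
Qed.

Lemma orbit_ideal_join (f g h : plZ R n) : f - g \in orbit_ideal_pred ->
  ljoin f h - ljoin g h \in orbit_ideal_pred.
Proof.
move=> /orbit_idealP[j fg]; apply/orbit_idealP; exists j => x /fg.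
rewrite [LHS]/(f x - g x) => /subr0_eq fgx.
by rewrite [LHS]/(Num.max (f x) (h x) - Num.max (g x) (h x)) fgx; apply: subrr.
Qed.

Definition orbit_ideal : lIdeal (plZ R n) :=
  LIdeal orbit_ideal_zmod orbit_ideal_join.

Definition Ggroup : unitalLGroupType := lquot orbit_ideal.

End Realizations.

Section Canonical.
Variables (K : choiceType) (W : wcomplex K).

(* The vertices v_1, ..., v_n are listed in the order of [enum_fset]. *)
Definition canonical_map (v : K) : 'rV[rat]_#|` verts W| :=
  \row_i (if (i : nat) == index v (verts W) then (weight W v)%:R^-1 else 0).

Definition canonical_complex : set {fset 'rV[rat]_#|` verts W|} :=
  [set [fset canonical_map v | v in F]%fset | F in faces W].

End Canonical.

Arguments canonical_map {K} W v.
Arguments canonical_complex {K} W.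

(* The canonical realization determines the sequences Delta_j and iota_j, so
   that [Ggroup r] does not depend on the choice of a canonical [r]. *)
Definition canonical_seq (R : realType) (K : choiceType)
    (W : nat -> wcomplex K) (r : realization_seq R #|` verts (W 0%N)| W) : Prop :=
  rs_complex r 0%N = canonical_complex (W 0%N) /\
  {in verts (W 0%N), rs_map r 0%N =1 canonical_map (W 0%N)}.

(* Main.v *)
(* Write the unit of [G] as a sum of elements [h_v >= 0] which generate [G]; this
   is possible by Riesz decomposition.  Start from the full simplex on the
   indices [v], all weights being 1, and regard [h_v] as the image in [G] of the
   hat function at [v].  Subdividing an edge [{v, w}] at its Farey mediant [a]
   turns the hats into [h_v - m], [h_w - m], [h_a = m], with [m] the meet of [h_v]
   and [h_w]; a maximal face containing a vertex with [h_v = 0] is deleted.  A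
   fair sequence of such steps makes every integer affine form change sign on no
   edge, hence every piecewise linear [f] affine on each simplex of some
   [Delta_j], and removes all vertices with zero hat.  Then
   [f |-> \sum_v den v * f v * h_v], computed at any such stage, is a unital
   l-homomorphism onto [G]: at every stage the hats of the vertices of a non-face
   have meet 0, so lattice operations are computed vertexwise.  A function [f] is
   in its kernel iff it vanishes at the vertices with nonzero hat, i.e. on some
   [|Delta_j|]. *)
From HB Require Import structures.
Require Import Defs.
From mathcomp Require Import all_boot all_order all_algebra finmap zify ring lra.
From mathcomp Require Import generic_quotient ring_quotient.
From mathcomp Require Import all_classical all_reals topology normedtype.

Set Implicit Arguments.
Unset Strict Implicit.
Unset Printing Implicit Defensive.

Import Order.TTheory GRing.Theory Num.Theory.
Import numFieldNormedType.Exports.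

Local Open Scope quotient_scope.
Local Open Scope classical_set_scope.
Local Open Scope ring_scope.

(** * Lattice-ordered groups *)

(** [G] need not be archimedean, so its elements cannot be treated as functions and a hat has no
    points at which to be evaluated. All that is known about hats must be kept as order relations
    inside [G]. The full simplex imposes none, as it has no non-faces, so any nonnegative summands
    of the unit can serve as a start. Riesz decomposition enters because the positive and the
    negative part of a generator each lie below a multiple of the unit: cutting the current summands
    of the unit along such an element makes it an integer combination of the pieces. The two aims of
    the sequence behave differently. Sign coherence of an affine form is never lost once reached, so
    each of the countably many forms is handled once. A subdivision may however produce new zero
    hats, when the meet [m] is 0 or equals one of the two hats, so cleaning has to recur at
    arbitrarily late stages. The kernel is then computed at a clean stage where the function and its
    positive and negative parts are already linear. *)

Section LGroupOrder.
Variable V : lGroupType.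
Implicit Types x y z t : V.

Lemma lle_refl x : lle x x. Proof. exact: ljoinxx. Qed.

Lemma lle_trans y x z : lle x y -> lle y z -> lle x z.
Proof. by rewrite /lle => xy yz; rewrite -yz ljoinA xy. Qed.

Lemma lle_add2l x y z : lle y z -> lle (x + y) (x + z).
Proof. by rewrite /lle -addr_ljoin => ->. Qed.

Lemma lle_add x y z t : lle x y -> lle z t -> lle (x + z) (y + t).
Proof.
move=> xy zt; apply: (@lle_trans (x + t)); first exact: lle_add2l.
by rewrite ![_ + t]addrC; apply: lle_add2l.
Qed.

Lemma lle_subr x y : lle 0 (y - x) <-> lle x y.
Proof.
split=> [/(lle_add2l x)|/(lle_add2l (- x))]; first by rewrite addr0 addrC subrK.
by rewrite addNr addrC.
Qed.

Lemma lle_addr x y : lle 0 y -> lle x (x + y).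
Proof. by move=> /(lle_add2l x); rewrite addr0. Qed.

Lemma lge0_add x y : lle 0 x -> lle 0 y -> lle 0 (x + y).
Proof. by move=> x0 y0; rewrite -(addr0 0); apply: lle_add. Qed.

Lemma lge0_mulrn x n : lle 0 x -> lle 0 (x *+ n).
Proof.
move=> x0; elim: n => [|n IH]; first by rewrite mulr0n; apply: lle_refl.
by rewrite mulrS; apply: lge0_add.
Qed.

Lemma lge0_sum (I : eqType) (r : seq I) (F : I -> V) :
  (forall i, i \in r -> lle 0 (F i)) -> lle 0 (\sum_(i <- r) F i).
Proof.
move=> F0; rewrite big_seq; apply: (big_ind (lle 0)) => //; first exact: lle_refl.
exact: lge0_add.
Qed.

Lemma lge0_sum_eq0 (I : eqType) (r : seq I) (F : I -> V) :
  (forall i, i \in r -> lle 0 (F i)) -> \sum_(i <- r) F i = 0 ->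
  forall i, i \in r -> F i = 0.
Proof.
elim: r => [//|a r IH] F0; rewrite big_cons => s0 i.
have a0 : lle 0 (F a) by apply: F0; rewrite mem_head.
have F0' j : j \in r -> lle 0 (F j) by move=> jr; apply: F0; rewrite inE jr orbT.
have r0 := lge0_sum F0'.
have Fa : F a = 0.
  by apply: lle_anti => //; rewrite -s0; apply: lle_addr.
move: s0; rewrite Fa add0r => s0; rewrite inE => /predU1P[->//|].
exact: IH.
Qed.

Lemma lge0_mulrn_eq0 x n : lle 0 x -> (0 < n)%N -> x *+ n = 0 -> x = 0.
Proof.
case: n => // n x0 _; rewrite mulrS => xn; apply: lle_anti => //.
by rewrite -xn; apply/lle_addr/lge0_mulrn.
Qed.

(** For nonnegative elements this says that the meet is 0. Quantifying over lower bounds lets the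
    pieces produced by [riesz2] be fed in directly. *)
Definition disjoint_elts x y := forall t, lle 0 t -> lle t x -> lle t y -> t = 0.

Lemma lmeet_ge0 x y : lle 0 x -> lle 0 y -> lle 0 (lmeet x y).
Proof. by move=> x0 y0; apply: lle_meet. Qed.

(** [t - lmeet t y] is the join of [0] and [t - y], and both of these lie below [z]. *)
Lemma riesz2 t y z : lle 0 y -> lle 0 z -> lle 0 t -> lle t (y + z) ->
  [/\ lle 0 (lmeet t y), lle (lmeet t y) y, lle 0 (t - lmeet t y)
    & lle (t - lmeet t y) z].
Proof.
move=> y0 z0 t0 tyz; split.
- exact: lmeet_ge0.
- exact: lle_meetr.
- by apply/lle_subr/lle_meetl.
rewrite lmeetE opprK addr_ljoin subrr; apply: lle_join => //.
by have := lle_add2l (- y) tyz; rewrite addKr addrC.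
Qed.

Lemma disjoint_eltsC x y : disjoint_elts x y -> disjoint_elts y x.
Proof. by move=> d t t0 ty tx; apply: d. Qed.

Lemma disjoint_elts0 x : disjoint_elts x 0.
Proof. by move=> t t0 _ t1; apply: lle_anti. Qed.

Lemma disjoint_eltsD x y z : lle 0 y -> lle 0 z ->
  disjoint_elts x y -> disjoint_elts x z -> disjoint_elts x (y + z).
Proof.
move=> y0 z0 dy dz t t0 tx tyz.
have [m0 my d0 dz'] := riesz2 y0 z0 t0 tyz.
have m_eq : lmeet t y = 0 by apply: dy => //; apply: lle_trans tx; apply: lle_meetl.
by move: dz' d0; rewrite m_eq subr0 => tz _; apply: dz.
Qed.

Lemma disjoint_elts_sum (I : eqType) (r : seq I) (F : I -> V) x :
  (forall i, i \in r -> lle 0 (F i)) ->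
  (forall i, i \in r -> disjoint_elts x (F i)) ->
  disjoint_elts x (\sum_(i <- r) F i).
Proof.
elim: r => [|a r IH] F0 dF; first by rewrite big_nil; apply: disjoint_elts0.
rewrite big_cons; apply: disjoint_eltsD.
- by apply: F0; rewrite mem_head.
- by apply: lge0_sum => i ir; apply: F0; rewrite inE ir orbT.
- by apply: dF; rewrite mem_head.
by apply: IH => i ir; [apply: F0|apply: dF]; rewrite inE ir orbT.
Qed.

Lemma disjoint_elts_mulrn x y n : lle 0 y ->
  disjoint_elts x y -> disjoint_elts x (y *+ n).
Proof.
move=> y0 d; elim: n => [|n IH]; first by rewrite mulr0n; apply: disjoint_elts0.
by rewrite mulrS; apply: disjoint_eltsD => //; apply: lge0_mulrn.
Qed.

(** In general the left side is [x - lmeet x y]. This recognises the positive part of an element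
    from any disjoint decomposition. *)
Lemma ljoin_disjoint_sub x y : lle 0 x -> lle 0 y -> disjoint_elts x y ->
  ljoin (x - y) 0 = x.
Proof.
move=> x0 y0 d.
have m0 : lmeet x y = 0.
  by apply: d; [apply: lmeet_ge0|apply: lle_meetl|apply: lle_meetr].
rewrite -[0](subrr x) -addr_ljoin.
by rewrite -[ljoin _ _]opprK ljoinC -lmeetE m0 subr0.
Qed.

Lemma ljoinE x y : ljoin x y = x + ljoin (y - x) 0.
Proof. by rewrite addr_ljoin addrC subrK addr0 ljoinC. Qed.

Lemma pos_part_decomp x : x = ljoin x 0 - ljoin (- x) 0.
Proof.
rewrite [ljoin (- x) 0]ljoinE opprK add0r opprD opprK ljoinC.
by rewrite addrCA subrr addr0.
Qed.

Lemma disjoint_pos_neg x : disjoint_elts (ljoin x 0) (ljoin (- x) 0).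
Proof.
have m0 : lmeet (ljoin x 0) (ljoin (- x) 0) = 0.
  rewrite lmeetE [ljoin x 0]ljoinE sub0r; set q := ljoin (- x) 0.
  by rewrite opprD addrC -[X in ljoin _ X]addr0 -addr_ljoin -/q addNr oppr0.
by move=> t t0 tx ty; apply: lle_anti => //; rewrite -m0; apply: lle_meet.
Qed.

(* [n x = n x^+ - n x^-] with disjoint summands, so [n x^-] is the negative part
   of [n x]. *)
Lemma lge0_mulrn_inv x n : (0 < n)%N -> lle 0 (x *+ n) -> lle 0 x.
Proof.
move=> n0 xn.
have p0 := lle_joinr x 0; have q0 := lle_joinr (- x) 0.
have d : disjoint_elts (ljoin (- x) 0 *+ n) (ljoin x 0 *+ n).
  apply: disjoint_elts_mulrn => //; apply: disjoint_eltsC.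
  by apply: disjoint_elts_mulrn => //; apply: disjoint_pos_neg.
have := ljoin_disjoint_sub (lge0_mulrn n q0) (lge0_mulrn n p0) d.
rewrite -mulrnBl -opprB -pos_part_decomp mulNrn.
have -> : ljoin (- (x *+ n)) 0 = 0.
  by rewrite -/(lle _ _) -oppr0; apply: lleN.
move/esym/(lge0_mulrn_eq0 q0 n0) => q.
by rewrite [x]pos_part_decomp q subr0.
Qed.

End LGroupOrder.

(** Bounding [- ounit] by [ounit *+ k] shows that [ounit *+ k.+1] is nonnegative, and l-groups are
    unperforated. *)
Lemma ounit_ge0 (U : unitalLGroupType) : lle 0 (@ounit U).
Proof.
have [k uk] := ounitP (- @ounit U); apply: (@lge0_mulrn_inv _ _ k.+1) => //.
by rewrite mulrS; have := lle_add2l ounit uk; rewrite subrr.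
Qed.

(** * Riesz refinement of partitions of the unit *)

Section PartitionOfUnity.
Variable G : unitalLGroupType.
Implicit Types (s h : seq G) (x y z g u : G).

Definition zspan s g := exists c : nat -> int,
  g = \sum_(i < size s) s`_i *~ c i.

Definition nonneg s := forall x, x \in s -> lle 0 x.

Lemma zspan_mem s x : x \in s -> zspan s x.
Proof.
move=> xs; exists (fun i => (i == index x s)%:Z).
have ix : (index x s < size s)%N by rewrite index_mem.
rewrite (bigD1 (Ordinal ix)) //= eqxx mulr1z nth_index // big1 ?addr0// => i ne.
by have -> : (i == index x s :> nat) = false by apply/negbTE.
Qed.

Lemma zspan_sum s (I : Type) (r : seq I) (F : I -> G) :
  (forall i, zspan s (F i)) -> zspan s (\sum_(i <- r) F i).
Proof.
move=> sF; apply: (big_ind (zspan s)) => //.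
  by exists (fun=> 0); rewrite big1.
move=> x y [c ->] [d ->]; exists (fun i => c i + d i).
by rewrite -big_split /=; apply: eq_bigr => i _; rewrite mulrzDr.
Qed.

Lemma zspanZ s x n : zspan s x -> zspan s (x *~ n).
Proof.
move=> [c ->]; exists (fun i => c i * n).
by rewrite mulrz_suml; apply: eq_bigr => i _; rewrite mulrzA.
Qed.

Lemma zspanD s x y : zspan s x -> zspan s y -> zspan s (x + y).
Proof.
move=> sx sy; have -> : x + y = \sum_(b : bool) if b then x else y.
  by rewrite big_bool.
by apply: zspan_sum => -[].
Qed.

Lemma zspanB s x y : zspan s x -> zspan s y -> zspan s (x - y).
Proof.
by move=> sx sy; rewrite -mulrN1z; apply: zspanD => //; apply: zspanZ.
Qed.

Lemma zspan_trans s s' x : (forall y, y \in s -> zspan s' y) ->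
  zspan s x -> zspan s' x.
Proof.
move=> ss' [c ->]; apply: zspan_sum => i; apply/zspanZ/ss'.
by rewrite mem_nth.
Qed.

(** The head [a] is cut into its meet with [x] and the rest; by [riesz2] the remainder of [x] lies
    below the sum of the tail. Cutting changes neither the total nor the fact that old summands are
    integer combinations. *)
Lemma riesz_split h x : nonneg h -> lle 0 x -> lle x (\sum_(y <- h) y) ->
  exists h', [/\ nonneg h', \sum_(y <- h') y = \sum_(y <- h) y, zspan h' x
    & forall y, y \in h -> zspan h' y].
Proof.
elim: h x => [|a h IH] x h0 x0 xs.
  exists [::]; split=> //; exists (fun=> 0); rewrite big_ord0.
  by apply: lle_anti => //; rewrite big_nil in xs.
have a0 : lle 0 a by apply: h0; rewrite mem_head.
have h0' : nonneg h by move=> y yh; apply: h0; rewrite inE yh orbT.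
rewrite big_cons in xs.
have [m0 ma r0 rh] := riesz2 a0 (lge0_sum h0') x0 xs.
have [h' [h'0 sh' xh' hh']] := IH _ h0' r0 rh.
set m := lmeet x a in m0 ma r0 rh xh' *.
exists [:: m, a - m & h']; split.
- by move=> y; rewrite !inE => /or3P[/eqP->|/eqP->|/h'0//] //; apply/lle_subr.
- by rewrite !big_cons sh' addrA [m + _]addrC subrK.
- rewrite -[X in zspan _ X](subrK m); apply: zspanD.
    by apply: zspan_trans xh' => y yh; apply: zspan_mem; rewrite !inE yh !orbT.
  by apply: zspan_mem; rewrite mem_head.
move=> y; rewrite inE => /predU1P[->|/hh'].
  rewrite -[X in zspan _ X](subrK m); apply: zspanD.
    by apply: zspan_mem; rewrite !inE eqxx orbT.
  by apply: zspan_mem; rewrite mem_head.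
by apply: zspan_trans => z zh; apply: zspan_mem; rewrite !inE zh !orbT.
Qed.

Definition partition_of_unity h := nonneg h /\ \sum_(y <- h) y = ounit.

Lemma partition_refine_le h k x : partition_of_unity h ->
  lle 0 x -> lle x (ounit *+ k) ->
  exists h', [/\ partition_of_unity h', zspan h' x
    & forall y, y \in h -> zspan h' y].
Proof.
elim: k h x => [|k IH] h x [h0 h1] x0 xk.
  exists h; split=> //; last exact: zspan_mem.
  have -> : x = 0 by apply: lle_anti => //; rewrite mulr0n in xk.
  by exists (fun=> 0); rewrite big1.
rewrite mulrS in xk; have u0 := ounit_ge0 G.
have [m0 mu r0 rk] := riesz2 u0 (lge0_mulrn k u0) x0 xk.
set m := lmeet x ounit in m0 mu r0 rk *.
rewrite -h1 in mu; have [h' [h'0 sh' mh' hh']] := riesz_split h0 m0 mu.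
rewrite h1 in sh'; have [h2 [p2 rh2 hh2]] := IH h' _ (conj h'0 sh') r0 rk.
exists h2; split=> //; last by move=> y /hh'; apply: zspan_trans.
rewrite -[X in zspan _ X](subrK m); apply: zspanD => //.
exact: zspan_trans mh'.
Qed.

Lemma partition_refine h x : partition_of_unity h ->
  exists h', [/\ partition_of_unity h', zspan h' x
    & forall y, y \in h -> zspan h' y].
Proof.
move=> ph; have [k xk] := ounitP (ljoin x 0).
have [h1 [p1 x1 hh1]] := partition_refine_le ph (lle_joinr x 0) xk.
have [m xm] := ounitP (ljoin (- x) 0).
have [h2 [p2 x2 hh2]] := partition_refine_le p1 (lle_joinr (- x) 0) xm.
exists h2; split=> //; last by move=> y /hh1; apply: zspan_trans.
by rewrite [x]pos_part_decomp; apply: zspanB => //; apply: zspan_trans x1.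
Qed.

Lemma partition_spanning s : exists h, [/\ h != [::], partition_of_unity h
  & forall x, x \in s -> zspan h x].
Proof.
suff [h [ph hs hu]] : exists h, [/\ partition_of_unity h,
    forall x, x \in s -> zspan h x & zspan h ounit].
  (* An empty partition forces [ounit = 0]. It is replaced by [[:: ounit]], since the initial
     complex must have a vertex. *)
  have [h0|h0] := eqVneq h [::]; last by exists h.
  exists [:: ounit]; split=> //.
    split; last by rewrite big_seq1.
    by move=> x; rewrite inE => /eqP->; apply: ounit_ge0.
  move=> x /hs; rewrite h0 => -[c]; rewrite big_ord0 => ->.
  by exists (fun=> 0); rewrite big1.
elim: s => [|x s [h [ph hs hu]]].
  exists [:: ounit]; split=> //; last by apply: zspan_mem; rewrite mem_head.
  split; last by rewrite big_seq1.
  by move=> x; rewrite inE => /eqP->; apply: ounit_ge0.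
have [h' [ph' xh' hh']] := partition_refine x ph.
exists h'; split=> //; last exact: zspan_trans hu.
by move=> y; rewrite inE => /predU1P[->//|/hs]; apply: zspan_trans.
Qed.

End PartitionOfUnity.

(** * Rational points and Farey mediants *)

Section RationalPoints.
Variable n : nat.
Implicit Types (v w y : 'rV[rat]_n) (p : 'rV[int]_(n + 1)).

Lemma den_gt0 y : (0 < den y)%N.
Proof.
apply: (big_ind (fun d => (0 < d)%N)) => // [a b|i _]; first by rewrite lcmn_gt0 => ->.
by rewrite absz_gt0 denq_neq0.
Qed.

Lemma denr_neq0 (F : numFieldType) y : (den y)%:R != 0 :> F.
Proof. by rewrite pnatr_eq0 -lt0n den_gt0. Qed.

Lemma mulr_den_int (x : rat) (d : nat) :
  (d%:R * x \is a Num.int) = (`|denq x| %| d)%N.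
Proof.
apply/idP/idP => [/intrP[m dx]|/dvdnP[k ->]].
  have : (d%:Z * numq x = m * denq x)%R.
    by apply: (@intr_inj rat); rewrite !intrM -dx -mulrA -numqE; congr (_ * _).
  move=> /(congr1 absz); rewrite !abszM absz_nat => e.
  by rewrite -(@Gauss_dvdl _ _ `|numq x|) ?e ?dvdn_mull// coprime_sym coprime_num_den.
rewrite natrM -mulrA.
have -> : (`|denq x|%N)%:R = (denq x)%:~R :> rat.
  by rewrite natr_absz gtr0_norm ?ltr0z ?denq_gt0.
by rewrite [_ * x]mulrC -numqE rpredM ?natr_int ?intr_int.
Qed.

Lemma den_dvd y d : (den y %| d)%N = [forall i, d%:R * y 0 i \is a Num.int].
Proof.
apply/dvdn_biglcmP/forallP => [H i|H i _]; first by rewrite mulr_den_int H.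
by rewrite -mulr_den_int.
Qed.

Lemma homogE y i :
  (homog y 0 i)%:~R = (den y)%:R * row_mx y (const_mx 1) 0 i :> rat.
Proof.
rewrite !mxE numqK //; case: (fintype.split i) => j; last by rewrite mxE rpredM ?natr_int.
by have := dvdnn (den y); rewrite den_dvd => /forallP.
Qed.

Lemma homog_last y : homog y 0 (rshift n ord0) = den y.
Proof.
by apply: (@intr_inj rat); rewrite homogE row_mxEr mxE mulr1 -pmulrn.
Qed.

Lemma homog_lshift y i : (homog y 0 (lshift 1 i))%:~R = (den y)%:R * y 0 i :> rat.
Proof. by rewrite homogE row_mxEl. Qed.

Lemma homog_inj : injective (@homog n).
Proof.
move=> v w vw; apply/rowP => i.
have d : den v = den w by have := homog_last v; rewrite vw homog_last => -[].
apply: (mulfI (denr_neq0 rat v)).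
by rewrite -homog_lshift vw homog_lshift d.
Qed.

Lemma unimodular_row_addrow m (B : 'M[int]_m) i j : B \in unitmx -> i != j ->
  exists2 B' : 'M[int]_m, B' \in unitmx
    & row j B' = row i B + row j B /\ forall k, k != j -> row k B' = row k B.
Proof.
move=> uB ij; exists ((1%:M + delta_mx j i) *m B).
  rewrite unitmx_mul uB andbT.
  suff : (1%:M + delta_mx j i) *m (1%:M - delta_mx j i) = 1%:M :> 'M[int]_m.
    by case/mulmx1_unit.
  rewrite mulmxDl mul1mx mulmxBr mulmx1 mul_delta_mx_0// subr0.
  by rewrite subrK.
have rowE k : row k ((1%:M + delta_mx j i) *m B) =
    row k B + (k == j)%:R *: row i B.
  rewrite !rowE mulmxA mulmxDr mulmx1 mulmxDl; congr (_ + _).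
  have [->|kj] := eqVneq k j; first by rewrite mul_delta_mx scale1r.
  by rewrite mul_delta_mx_0// mul0mx scale0r.
split=> [|k kj]; first by rewrite rowE eqxx scale1r addrC.
by rewrite rowE (negbTE kj) scale0r addr0.
Qed.

(** The diagonal entry [(i, i)] of [B] times its inverse exhibits [k] as a divisor of 1. *)
Lemma unimodular_row_primitive m (B : 'M[int]_m) i (k : nat) (q : 'rV[int]_m) :
  B \in unitmx -> row i B = k%:Z *: q -> k = 1%N.
Proof.
move=> uB rB; have := mulmxV uB => /(congr1 (row i)).
rewrite row_mul rB -scalemxAl => /rowP /(_ i); rewrite !mxE eqxx.
set z : int := \sum_j _; move/(congr1 absz); rewrite abszM absz_nat /= => /eqP.
by rewrite muln_eq1 => /andP[/eqP].
Qed.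

Definition mediant v w : 'rV[rat]_n :=
  ((den v)%:R + (den w)%:R)^-1 *: ((den v)%:R *: v + (den w)%:R *: w).

(** [homog v + homog w] is an integer multiple of the homogeneous vector of the mediant; being a row
    of a unimodular matrix it is primitive, so the factor is 1. *)
Lemma homog_mediant (B : 'M[int]_(n + 1)) i v w : B \in unitmx ->
  row i B = homog v + homog w -> homog (mediant v w) = homog v + homog w.
Proof.
move=> uB rB; set e := mediant v w.
have d0 : ((den v)%:R + (den w)%:R : rat) != 0.
  by rewrite -natrD pnatr_eq0 addn_eq0 negb_and -!lt0n den_gt0.
have eE j : ((den v + den w)%N)%:R * row_mx e (const_mx 1) 0 j
    = ((homog v + homog w) 0 j)%:~R :> rat.
  rewrite [in RHS]mxE intrD !homogE !mxE natrD; case: (fintype.split j) => a.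
    by rewrite !mxE mulVKf.
  by rewrite !mxE mulrDl.
have : (den e %| den v + den w)%N.
  rewrite den_dvd; apply/forallP => j; have := eE (lshift 1 j).
  by rewrite row_mxEl => ->; apply: intr_int.
case/dvdnP=> k kE; have hk : homog v + homog w = k%:Z *: homog e.
  apply/rowP => j; apply: (@intr_inj rat).
  by rewrite -eE [in RHS]mxE intrM homogE kE natrM mulrA -pmulrn.
by rewrite hk in rB *; rewrite (unimodular_row_primitive uB rB) scale1r.
Qed.

Lemma den_homog v w e : homog e = homog v + homog w -> den e = (den v + den w)%N.
Proof.
move=> he; have := homog_last e.
by rewrite he mxE !homog_last -PoszD => -[].
Qed.

(** The homogenisation of the affine form [l]: at [homog y] it is [den y] times [l y], an integer,
    and it is additive, hence easy to follow through mediants. *)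
Definition linval (l : 'rV[int]_n * int) p : int :=
  \sum_i l.1 0 i * p 0 (lshift 1 i) + l.2 * p 0 (rshift n ord0).

Lemma linvalD l p p' : linval l (p + p') = linval l p + linval l p'.
Proof.
rewrite /linval addrACA -big_split /= !mxE mulrDr; congr (_ + _).
by apply: eq_bigr => i _; rewrite mxE mulrDr.
Qed.

End RationalPoints.

Section RealPoints.
Variables (R : realType) (n : nat).
Implicit Types (v w y : 'rV[rat]_n).

Definition rpt y : 'rV[R]_n := map_mx ratr y.

Definition homogR y : 'rV[R]_(n + 1) := map_mx intr (homog y).

Lemma homogRE y : homogR y = (den y)%:R *: row_mx (rpt y) (const_mx 1).
Proof.
apply/rowP => i; rewrite mxE -ratr_int homogE rmorphM /= ratr_nat !mxE.
by congr (_ * _); case: (fintype.split i) => j; rewrite !mxE // rmorph1.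
Qed.

Lemma affineZ_homog (l : 'rV[int]_n * int) y :
  (den y)%:R * affineZ l (rpt y) = (linval l (homog y))%:~R.
Proof.
rewrite /affineZ /linval intrD rmorph_sum /= mulrDr mulr_sumr; congr (_ + _).
  apply: eq_bigr => i _; rewrite intrM mulrCA; congr (_ * _).
  by rewrite -[RHS]ratr_int homog_lshift rmorphM /= ratr_nat mxE.
by rewrite intrM homog_last mulrC -pmulrn.
Qed.

Lemma affineZ_sum (l : 'rV[int]_n * int) (I : Type) (r : seq I) (t : I -> R)
    (x : I -> 'rV[R]_n) : \sum_(i <- r) t i = 1 ->
  affineZ l (\sum_(i <- r) t i *: x i) = \sum_(i <- r) t i * affineZ l (x i).
Proof.
move=> t1; rewrite /affineZ.
under [RHS]eq_bigr do rewrite mulrDr mulr_sumr.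
rewrite big_split /= -mulr_suml t1 mul1r exchange_big /=; congr (_ + _).
apply: eq_bigr => j _; rewrite summxE mulr_sumr; apply: eq_bigr => i _.
by rewrite mxE mulrCA.
Qed.

Lemma affineZB (l m : 'rV[int]_n * int) (x : 'rV[R]_n) :
  affineZ (l.1 - m.1, l.2 - m.2) x = affineZ l x - affineZ m x.
Proof.
rewrite /affineZ /= opprD addrACA -sumrB intrB; congr (_ + _).
by apply: eq_bigr => i _; rewrite !mxE intrB mulrBl.
Qed.

End RealPoints.

(** * Subdivision and deletion of faces *)

Section CombinatorialComplexes.
Variable K : choiceType.
Implicit Types (W : wcomplex K) (F S E M : {fset K}) (v w a x : K).

Lemma fsub2 v w F : ([fset v; w] `<=` F)%fset = (v \in F) && (w \in F).
Proof.
apply/fsubsetP/andP => [H|[vF wF] x]; first by split; apply: H; rewrite !inE eqxx ?orbT.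
by rewrite !inE => /orP[/eqP->|/eqP->].
Qed.

Lemma verts_subdivision W v w a : verts (subdivision W v w a) = (a |` verts W)%fset.
Proof. by rewrite /verts dom_setf. Qed.

Lemma weight_subdivision W v w a x : weight (subdivision W v w a) x =
  if x == a then (weight W v + weight W w)%N else weight W x.
Proof. by rewrite /weight fnd_set; case: eqP. Qed.

Lemma mem_verts_delete W M x : (x \in verts (delete_face W M)) =
  (x \in verts W) && ((#|` M| == 1%N) ==> (x \notin M)).
Proof.
rewrite /verts /delete_face /=; case: ifP => _; last by rewrite andbT.
by rewrite -!fndSome fnd_rem; case: (x \in M) => //=; rewrite ?andbF ?andbT.
Qed.

Lemma weight_delete W M x : x \in verts (delete_face W M) ->
  weight (delete_face W M) x = weight W x.
Proof.
rewrite mem_verts_delete /weight /delete_face /=; case: ifP => //= _ /andP[_ xM].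
by rewrite fnd_rem (negbTE xM).
Qed.

Section Subdivision.
Variables (W : wcomplex K) (v w a : K).
Hypotheses (wcW : is_wcomplex W) (sub : subdivisible W v w a).

Let facesV F : faces W F -> (F `<=` verts W)%fset. Proof. by case: wcW => + _ _ _; apply. Qed.
Let faces_sub F E : faces W F -> (E `<=` F)%fset -> faces W E.
Proof. by case: wcW => _ _ + _; apply. Qed.

Lemma subdivisible_neq : v != w. Proof. by case: sub. Qed.
Lemma subdivisible_notin : a \notin verts W. Proof. by case: sub. Qed.
Lemma subdivisible_vertl : v \in verts W.
Proof. by case: sub => _ /facesV; rewrite fsub2 => /andP[]. Qed.
Lemma subdivisible_vertr : w \in verts W.
Proof. by case: sub => _ /facesV; rewrite fsub2 => /andP[]. Qed.
Lemma subdivisible_fresh x : x \in verts W -> (x == a) = false.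
Proof. by move=> xV; apply: contraNF subdivisible_notin => /eqP <-. Qed.

(** Together with [faces_subdivision_new] this replaces the two halves in the definition of
    [subdivision] by conditions symmetric in [v] and [w]; only the membership of [a] has to be
    distinguished. *)
Lemma faces_subdivision_old F : a \notin F ->
  faces (subdivision W v w a) F <-> faces W F /\ ~~ ([fset v; w] `<=` F)%fset.
Proof.
move=> aF; split=> [[//|[S [WS vwS H]]]|]; last by left.
have aS x : x \in F -> (x == a) = false by move=> xF; apply: contraNF aF => /eqP <-.
case: H => /fsubsetP H; (split; first apply: faces_sub WS _; first apply/fsubsetP => x xF;
  last apply/negP; rewrite ?fsub2).
- by have := H x xF; rewrite !inE aS //= => /andP[].
- case/andP => _ wF; have := H w wF.
  by rewrite !inE eqxx (subdivisible_fresh subdivisible_vertr).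
- by have := H x xF; rewrite !inE aS //= => /andP[].
- case/andP => vF _; have := H v vF.
  by rewrite !inE eqxx (subdivisible_fresh subdivisible_vertl).
Qed.

Lemma faces_subdivision_new F : a \in F ->
  faces (subdivision W v w a) F <-> exists S, [/\ faces W S, v \in S, w \in S,
    (F `<=` a |` S)%fset & ~~ ([fset v; w] `<=` F)%fset].
Proof.
move=> aF; split=> [[[WF _]|[S [WS]]]|[S [WS vS wS FS]]].
- by have /fsubsetP/(_ a aF) := facesV WF; rewrite (negbTE subdivisible_notin).
- rewrite fsub2 => /andP[vS wS] H; exists S; split=> //; rewrite ?fsub2.
    by case: H => /fsubset_trans; apply; apply: fsetUS; apply: fsubsetDl.
  apply/negP => /andP[vF wF].
  case: H => /fsubsetP H; [have := H w wF|have := H v vF]; rewrite !inE eqxx.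
    by rewrite (subdivisible_fresh subdivisible_vertr).
  by rewrite (subdivisible_fresh subdivisible_vertl).
rewrite fsub2 => nvw; right; exists S; rewrite fsub2 vS wS; split=> //.
have [vF|vF] := boolP (v \in F); [left|right]; apply/fsubsetP => x xF;
  have := fsubsetP FS x xF; rewrite !inE => /orP[->//|->]; rewrite andbT.
  by apply/orP; right; apply: contra nvw => /eqP <-; rewrite vF.
by apply/orP; right; apply: contraNneq vF => <-.
Qed.

Lemma subdivision_wcomplex : is_wcomplex (subdivision W v w a).
Proof.
have vw := subdivisible_neq; have [_ WV _ W0] := wcW.
have vwF : faces W [fset v; w]%fset by case: sub.
split.
- move=> F WF; rewrite verts_subdivision.
  have [aF|aF] := boolP (a \in F).
    have /(faces_subdivision_new aF) [S [WS _ _ FS _]] := WF.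
    by apply: fsubset_trans FS _; apply: fsetUS; apply: facesV.
  have /(faces_subdivision_old aF) [WF' _] := WF.
  by apply: fsubset_trans (facesV WF') _; apply: fsubsetUr.
- move=> x; rewrite verts_subdivision !inE => xV; exists [fset x]%fset; last by rewrite inE.
  have nvw : ~~ ([fset v; w] `<=` [fset x])%fset.
    by rewrite fsub2 !inE; apply/negP => /andP[/eqP vx /eqP wx]; rewrite vx wx eqxx in vw.
  have [xa|xa] := eqVneq x a.
    subst x; apply/faces_subdivision_new; first by rewrite inE.
    by exists [fset v; w]%fset; split; rewrite // ?inE ?eqxx ?orbT // fsub1set !inE eqxx.
  rewrite (negbTE xa) /= in xV; apply/faces_subdivision_old; first by rewrite inE eq_sym.
  split=> //; have [F WF xF] := WV x xV; apply: faces_sub WF _.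
  by rewrite fsub1set.
- move=> F E WF EF.
  have nvw : ~~ ([fset v; w] `<=` F)%fset -> ~~ ([fset v; w] `<=` E)%fset.
    by apply: contra => /fsubset_trans; apply.
  have [aE|aE] := boolP (a \in E).
    have aF := fsubsetP EF _ aE.
    have /(faces_subdivision_new aF) [S [WS vS wS FS nF]] := WF.
    by apply/faces_subdivision_new => //; exists S; split=> //;
      [apply: fsubset_trans EF FS|apply: nvw].
  apply/faces_subdivision_old => //.
  have [aF|aF] := boolP (a \in F).
    have /(faces_subdivision_new aF) [S [WS vS wS FS nF]] := WF.
    split; last exact: nvw.
    apply: faces_sub WS _; apply/fsubsetP => x xE.
    have := fsubsetP FS x (fsubsetP EF x xE); rewrite !inE => /orP[/eqP xa|//].
    by rewrite -xa xE in aE.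
  have /(faces_subdivision_old aF) [WF' nF] := WF.
  by split; [apply: faces_sub WF' EF|apply: nvw].
move=> x; rewrite verts_subdivision weight_subdivision !inE.
by case: eqP => //= _ xV; [rewrite addn_gt0 W0 // subdivisible_vertl|apply: W0].
Qed.

End Subdivision.

Lemma delete_wcomplex W M : is_wcomplex W -> maximal_face W M ->
  is_wcomplex (delete_face W M).
Proof.
move=> [WF WV Wd W0] [WM maxM]; split.
- move=> F [WF' FM]; apply/fsubsetP => x xF; rewrite mem_verts_delete.
  rewrite (fsubsetP (WF _ WF') _ xF) /=; apply/implyP => /cardfs1P[y My].
  apply/negP => xM; apply: FM; apply: maxM => //.
  by move: xM; rewrite My inE => /eqP <-; rewrite fsub1set.
- move=> x; rewrite mem_verts_delete => /andP[xV xM].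
  exists [fset x]%fset; last by rewrite inE.
  have [F WF' xF] := WV x xV; split; first by apply: Wd WF' _; rewrite fsub1set.
  by move=> /= E; rewrite -E cardfs1 eqxx inE eqxx in xM.
- move=> F E [WF' FM] EF; split; first exact: Wd WF' EF.
  by move=> /= EM; apply: FM; apply: maxM; rewrite -?EM.
by move=> x xV; rewrite weight_delete// W0//; move: xV; rewrite mem_verts_delete => /andP[].
Qed.

Lemma fsubset_verts_delete W M :
  (verts (delete_face W M) `<=` verts W)%fset.
Proof. by apply/fsubsetP => x; rewrite mem_verts_delete => /andP[]. Qed.

End CombinatorialComplexes.

(** * Invariants of the construction *)

Lemma sum_fset_delta (K : choiceType) (V : zmodType) (A : {fset K}) (v : K) (f : K -> V) :
  v \in A -> \sum_(x <- A) (if x == v then f x else 0) = f v.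
Proof.
move=> vA; rewrite (big_fsetD1 v) //= eqxx big1_seq ?addr0 // => x /andP[_].
by rewrite !inE => /andP[/negPf->].
Qed.

Section States.
Variables (R : realType) (G : unitalLGroupType) (n : nat).

(* [hat s v] is the image in [G] of the Schauder hat at [v], the function with
   value [1 / den v] at [v] and [0] at the other vertices. *)
Record state := State {
  cplx : wcomplex nat;
  pt : nat -> 'rV[rat]_n;
  hat : nat -> G
}.

Implicit Types (s : state) (F S M : {fset nat}) (v w a x : nat).

Definition sub_hat (h : nat -> G) v w a x : G :=
  let m := lmeet (h v) (h w) in
  if x == a then m else if (x == v) || (x == w) then h x - m else h x.

Definition sub_state s v w a := State (subdivision (cplx s) v w a)
  (fun x => if x == a then mediant (pt s v) (pt s w) else pt s x)
  (sub_hat (hat s) v w a).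

Definition del_state s M := State (delete_face (cplx s) M) (pt s) (hat s).

(** Deletion is restricted to faces with a zero hat so that it loses nothing in [G]. [step_refl]
    allows idling while a fair sequence switches tasks. *)
Inductive step s : state -> Prop :=
| step_refl : step s s
| step_sub v w a : subdivisible (cplx s) v w a -> step s (sub_state s v w a)
| step_del M v : maximal_face (cplx s) M -> v \in M -> hat s v = 0 ->
    step s (del_state s M).

Definition supported F (t : nat -> R) :=
  (forall x, 0 <= t x) /\ (forall x, x \notin F -> t x = 0).

(** Points are handled in the cone over the complex: there a mediant is the plain sum of the vectors
    at the two ends, so subdivision acts on coefficients without denominators. *)
Definition cone_point s (t : nat -> R) : 'rV[R]_(n + 1) :=
  \sum_(x <- verts (cplx s)) t x *: homogR R (pt s x).

Definition unimodular_face s F :=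
  exists2 B : 'M[int]_(n + 1), B \in unitmx
    & forall v, v \in F -> exists i, row i B = homog (pt s v).

Record state_inv s : Prop := Inv {
  inv_wcomplex : is_wcomplex (cplx s);
  inv_unimodular : forall F, faces (cplx s) F -> unimodular_face s F;
  inv_den : forall v, v \in verts (cplx s) -> den (pt s v) = weight (cplx s) v;
  (* the cones over the simplexes meet in common faces *)
  inv_cone : forall F S t u, faces (cplx s) F -> faces (cplx s) S ->
    supported F t -> supported S u -> cone_point s t = cone_point s u -> t =1 u;
  inv_cube : forall v, v \in verts (cplx s) -> forall i, 0 <= pt s v 0 i <= 1;
  inv_hat : forall v, v \in verts (cplx s) -> lle 0 (hat s v);
  (* non-faces have hats with meet 0 *)
  inv_meet : forall F, (F `<=` verts (cplx s))%fset -> ~ faces (cplx s) F ->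
    forall z, lle 0 z -> (forall v, v \in F -> lle z (hat s v)) -> z = 0
}.

Section InvariantTheory.
Variables (s : state) (Is : state_inv s).
Local Notation W := (cplx s).

Lemma inv_faces_verts F : faces W F -> (F `<=` verts W)%fset.
Proof. by case: Is => -[+ _ _ _] _ _ _ _ _ _; apply. Qed.

Lemma inv_faces_sub F S : faces W F -> (S `<=` F)%fset -> faces W S.
Proof. by case: Is => -[_ _ + _] _ _ _ _ _ _; apply. Qed.

Lemma inv_face1 v : v \in verts W -> faces W [fset v]%fset.
Proof.
case: Is => -[_ WV _ _] _ _ _ _ _ _ vV; have [F WF vF] := WV v vV.
by apply: inv_faces_sub WF _; rewrite fsub1set.
Qed.

Definition delta v : nat -> R := fun x => if x == v then 1 else 0.

Lemma supported_delta v F : v \in F -> supported F (delta v).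
Proof.
move=> vF; split=> x; rewrite /delta; first by case: eqP.
by case: eqP => // -> /negP.
Qed.

Lemma cone_point_delta v : v \in verts W -> cone_point s (delta v) = homogR R (pt s v).
Proof.
move=> vV; rewrite /cone_point -(sum_fset_delta (fun x => homogR R (pt s x)) vV).
by apply: eq_bigr => x _; rewrite /delta; case: eqP; rewrite ?scale1r ?scale0r.
Qed.

(** Equal points would give two singleton faces the same cone point, and [inv_cone] separates their
    coefficients. *)
Lemma pt_inj : {in verts W &, injective (pt s)}.
Proof.
move=> v w vV wV vw.
have := inv_cone Is (inv_face1 vV) (inv_face1 wV)
  (supported_delta (fset11 v)) (supported_delta (fset11 w)).
rewrite !cone_point_delta // vw => /(_ erefl v).
by rewrite /delta eqxx; case: eqP => // _ /eqP; rewrite oner_eq0.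
Qed.

End InvariantTheory.

Section SubdivisionInvariant.
Variables (s : state) (v w a : nat).
Hypotheses (Is : state_inv s) (sub : subdivisible (cplx s) v w a).
Local Notation W := (cplx s).
Local Notation s' := (sub_state s v w a).
Local Notation wcW := (inv_wcomplex Is).

Let vV : v \in verts W. Proof. exact: subdivisible_vertl wcW sub. Qed.
Let wV : w \in verts W. Proof. exact: subdivisible_vertr wcW sub. Qed.
Let vw : v != w. Proof. exact: subdivisible_neq sub. Qed.
Let fresh x : x \in verts W -> (x == a) = false. Proof. exact: subdivisible_fresh sub x. Qed.
Let vwF : faces W [fset v; w]%fset. Proof. by case: sub. Qed.

(** Adding the row of [u] to that of [u'] keeps the matrix unimodular: in a basis, the mediant may
    replace either end of the edge. *)
Lemma sub_unimodular_aux S u u' : faces W S -> u \in S -> u' \in S -> u != u' ->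
  exists2 B : 'M[int]_(n + 1), B \in unitmx &
    (exists i, row i B = homog (pt s u) + homog (pt s u')) /\
    forall x, x \in S -> x != u' -> exists i, row i B = homog (pt s x).
Proof.
move=> WS uS u'S uu'; have [B uB rB] := inv_unimodular Is WS.
have [[i ri] [j rj]] := (rB u uS, rB u' u'S).
have SV x : x \in S -> x \in verts W by apply/fsubsetP/(inv_faces_verts Is).
have ne x k : x \in S -> x != u' -> row k B = homog (pt s x) -> k != j.
  move=> xS xu rk; apply: contraNneq xu => kj; apply/eqP.
  by apply: (pt_inj Is); rewrite ?SV //; apply: homog_inj; rewrite -rk -rj kj.
have [B' uB' [rB' rB'']] := unimodular_row_addrow uB (ne _ _ uS uu' ri).
exists B' => //; split; first by exists j; rewrite rB' ri rj.
move=> x xS xu; have [k rk] := rB x xS; exists k.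
by rewrite rB'' //; apply: ne rk.
Qed.

Lemma homog_new : homog (mediant (pt s v) (pt s w)) = homog (pt s v) + homog (pt s w).
Proof.
have [||B uB [[i ri] _]] := sub_unimodular_aux vwF _ _ vw; rewrite ?inE ?eqxx ?orbT //.
exact: homog_mediant uB ri.
Qed.

Lemma pt_sub_old x : x \in verts W -> pt s' x = pt s x.
Proof. by move=> /fresh /= ->. Qed.

Lemma pt_sub_new : pt s' a = mediant (pt s v) (pt s w).
Proof. by rewrite /= eqxx. Qed.

Lemma sub_unimodular F : faces (cplx s') F -> unimodular_face s' F.
Proof.
move=> WF; have [aF|aF] := boolP (a \in F); last first.
  have /(faces_subdivision_old wcW sub aF) [WF' _] := WF.
  have [B uB rB] := inv_unimodular Is WF'; exists B => // x xF.
  by rewrite pt_sub_old; [apply: rB|apply: fsubsetP (inv_faces_verts Is WF') x xF].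
have /(faces_subdivision_new wcW sub aF) [S [WS vS wS FS]] := WF.
have SV x : x \in S -> x \in verts W by apply/fsubsetP/(inv_faces_verts Is).
have key u u' : u \in S -> u' \in S -> u != u' -> u' \notin F ->
    homog (pt s u) + homog (pt s u') = homog (pt s v) + homog (pt s w) ->
    unimodular_face s' F.
  move=> uS u'S uu' u'F huu'.
  have [B uB [[i ri] rB]] := sub_unimodular_aux WS uS u'S uu'; exists B => // x xF.
  have := fsubsetP FS x xF; rewrite !inE => /orP[/eqP xa|xS].
    by exists i; rewrite xa pt_sub_new homog_new ri.
  rewrite pt_sub_old; last exact: SV.
  by apply: rB => //; apply: contraNneq u'F => <-.
rewrite fsub2 negb_and => /orP[vF|wF].
  by apply: (key w v); rewrite // 1?eq_sym // addrC.
exact: (key v w).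
Qed.

(** Coefficients over the old complex of the same cone point: the vector at [a] is the sum of those
    at [v] and [w], so [t a] is added to both. *)
Definition sub_coef (t : nat -> R) x : R :=
  if x == a then 0 else if (x == v) || (x == w) then t x + t a else t x.

Lemma cone_point_sub t : cone_point s' t = cone_point s (sub_coef t).
Proof.
rewrite /cone_point verts_subdivision big_fsetU1 ?(subdivisible_notin sub) //=.
rewrite eqxx /homogR homog_new raddfD /= -/(homogR R _) -/(homogR R _) scalerDr.
transitivity (\sum_(x <- verts W) ((if x == v then t a *: homogR R (pt s x) else 0) +
   (if x == w then t a *: homogR R (pt s x) else 0) + t x *: homogR R (pt s x))).
  rewrite 2!big_split /= !(sum_fset_delta (fun x => t a *: homogR R (pt s x))) //.
  by congr (_ + _); apply: eq_big_seq => x xV; rewrite fresh.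
apply: eq_big_seq => x xV; rewrite /sub_coef fresh //.
case: (eqVneq x v) => [->|_].
  by rewrite (negbTE vw) addr0 /= scalerDl addrC.
case: (eqVneq x w) => _ /=; last by rewrite !add0r.
by rewrite add0r scalerDl addrC.
Qed.

(** No face of the subdivision contains both [v] and [w], so [t v] or [t w] is 0 and [t a] is the
    minimum of the two old coefficients. Thus [t] is recovered from [sub_coef t] by the very formula
    that [sub_hat] uses in [G]. *)
Lemma supported_sub F t : faces (cplx s') F -> supported F t ->
  (exists2 S, faces W S & supported S (sub_coef t)) /\
  t =1 (fun x => let m := Num.min (sub_coef t v) (sub_coef t w) in
    if x == a then m else if (x == v) || (x == w) then sub_coef t x - m
    else sub_coef t x).
Proof.
move=> WF [t0 tF].
have mE : Num.min (sub_coef t v) (sub_coef t w) = t a.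
  rewrite /sub_coef !fresh // !eqxx orbT /=.
  have [vF|vF] := boolP (v \in F); last first.
    by rewrite (tF v vF) add0r; apply/min_idPl; rewrite lerDr.
  have [wF|wF] := boolP (w \in F); last first.
    by rewrite (tF w wF) add0r; apply/min_idPr; rewrite lerDr.
  have [aF|aF] := boolP (a \in F).
    have /(faces_subdivision_new wcW sub aF) [S [_ _ _ _]] := WF.
    by rewrite fsub2 vF wF.
  have /(faces_subdivision_old wcW sub aF) [_] := WF.
  by rewrite fsub2 vF wF.
split; last first.
  move=> x /=; rewrite mE /sub_coef; case: (eqVneq x a) => [->//|_] /=.
  by case: ((x == v) || (x == w)); rewrite ?addrK.
have sub0 x : 0 <= sub_coef t x.
  by rewrite /sub_coef; do 2?case: ifP => // _; rewrite addr_ge0.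
have [aF|aF] := boolP (a \in F).
  have /(faces_subdivision_new wcW sub aF) [S [WS vS wS FS _]] := WF.
  exists S => //; split=> // x xS; rewrite /sub_coef; case: eqP => // /eqP xa.
  case: ifP => [/orP[/eqP xv|/eqP xw]|_]; first by rewrite -xv (negbTE xS) in vS.
    by rewrite -xw (negbTE xS) in wS.
  apply: tF; apply: contra xS => /(fsubsetP FS).
  by rewrite !inE (negbTE xa).
have /(faces_subdivision_old wcW sub aF) [WF' _] := WF.
exists F => //; split=> // x xF; rewrite /sub_coef; case: eqP => // _.
by rewrite (tF a aF) addr0 tF // if_same.
Qed.

Lemma sub_cone F S t u : faces (cplx s') F -> faces (cplx s') S ->
  supported F t -> supported S u -> cone_point s' t = cone_point s' u -> t =1 u.
Proof.
move=> WF WS tF uS; rewrite !cone_point_sub => e.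
have [[F' WF' tF'] tE] := supported_sub WF tF.
have [[S' WS' uS'] uE] := supported_sub WS uS.
have tu := inv_cone Is WF' WS' tF' uS' e.
by move=> x; rewrite tE uE /= !tu.
Qed.

Lemma sub_cube x : x \in verts (cplx s') -> forall i, 0 <= pt s' x 0 i <= 1.
Proof.
rewrite verts_subdivision !inE => xV i; have [xa|xa] := eqVneq x a; last first.
  by rewrite (negbTE xa) /= in xV; rewrite pt_sub_old //; apply: inv_cube Is _ xV i.
rewrite xa pt_sub_new !mxE.
have /andP[v0 v1] := inv_cube Is vV i; have /andP[w0 w1] := inv_cube Is wV i.
have d0 : 0 < (den (pt s v))%:R + (den (pt s w))%:R :> rat.
  by rewrite addr_gt0 // ltr0n den_gt0.
rewrite mulr_ge0 ?invr_ge0 ?addr_ge0 ?mulr_ge0 //=.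
by rewrite mulrC ler_pdivrMr // mul1r lerD // ler_piMr.
Qed.

Lemma sub_hat_le x : x \in verts W -> lle (sub_hat (hat s) v w a x) (hat s x).
Proof.
move=> xV; rewrite /sub_hat fresh //; case: ifP => _; last exact: lle_refl.
apply/lle_subr; rewrite opprB addrCA subrr addr0.
by apply: lmeet_ge0; apply: inv_hat.
Qed.

Lemma sub_hat_ge0 x : x \in verts (cplx s') -> lle 0 (hat s' x).
Proof.
rewrite verts_subdivision !inE /= /sub_hat.
case: eqP => [_ _|_ /= xV]; first by apply: lmeet_ge0; apply: inv_hat.
case: ifP => [/orP[/eqP->|/eqP->]|_]; last exact: inv_hat.
  by apply/lle_subr/lle_meetl.
by apply/lle_subr/lle_meetr.
Qed.

(** If [F] contains [v] and [w], then [z + m] is below both old hats, hence below their meet [m]. If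
    [F] contains [a] but not both ends, an element below the hat of [a] is below those of [v] and
    [w], and exchanging [a] for these two gives a non-face of the old complex. *)
Lemma sub_meet F : (F `<=` verts (cplx s'))%fset -> ~ faces (cplx s') F ->
  forall z, lle 0 z -> (forall x, x \in F -> lle z (hat s' x)) -> z = 0.
Proof.
move=> FV nF z z0 zF.
have [|nvw] := boolP ([fset v; w] `<=` F)%fset.
  rewrite fsub2 => /andP[vF wF]; apply: lle_anti => //.
  have := zF v vF; have := zF w wF.
  rewrite /= /sub_hat !fresh // !eqxx orbT /=; set m := lmeet _ _ => zw zv.
  have zm : lle (z + m) m.
    apply: lle_meet.
      by have := lle_add zv (lle_refl m); rewrite subrK.
    by have := lle_add zw (lle_refl m); rewrite subrK.
  by have := lle_add zm (lle_refl (- m)); rewrite addrK subrr.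
have FV' x : x \in F -> x != a -> x \in verts W.
  by move=> /(fsubsetP FV); rewrite verts_subdivision !inE => /orP[->|].
have [aF|aF] := boolP (a \in F).
  pose E : {fset nat} := ([fset v; w] `|` (F `\ a))%fset.
  apply: (@inv_meet s Is E) => //.
  - apply/fsubsetP => x; rewrite !inE -orbA => /or3P[/eqP->|/eqP->|/andP[xa xF]] //.
    exact: FV'.
  - move=> WE; apply: nF; apply/(faces_subdivision_new wcW sub aF); exists E.
    split; rewrite // ?inE ?eqxx ?orbT //; apply/fsubsetP => x xF; rewrite !inE xF.
    by case: (x == a); rewrite //= !orbT.
  move=> x; have := zF a aF; rewrite /= {1}/sub_hat eqxx => za.
  rewrite !inE -orbA => /or3P[/eqP->|/eqP->|/andP[xa xF]].
  - exact: lle_trans za (lle_meetl _ _).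
  - exact: lle_trans za (lle_meetr _ _).
  by apply: lle_trans (zF x xF) _; apply: sub_hat_le; apply: FV'.
have FW : (F `<=` verts W)%fset.
  by apply/fsubsetP => x xF; apply: FV' => //; apply: contraNneq aF => <-.
apply: (inv_meet Is FW) => // [WF|x xF].
  by apply: nF; apply/(faces_subdivision_old wcW sub aF).
by apply: lle_trans (zF x xF) _; apply: sub_hat_le; apply: (fsubsetP FW).
Qed.

Lemma sub_inv : state_inv s'.
Proof.
split.
- exact: subdivision_wcomplex wcW sub.
- exact: sub_unimodular.
- move=> x; rewrite verts_subdivision weight_subdivision !inE /=.
  case: eqP => [_ _|_ /= xV]; last exact: inv_den.
  by rewrite (den_homog homog_new) !(inv_den Is).
- exact: sub_cone.
- exact: sub_cube.
- exact: sub_hat_ge0.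
exact: sub_meet.
Qed.

End SubdivisionInvariant.

(** The only new non-face is [M] itself, and a lower bound of its hats is bounded by
    [hat s v = 0]. *)
Lemma del_inv s M v : state_inv s -> maximal_face (cplx s) M -> v \in M -> hat s v = 0 ->
  state_inv (del_state s M).
Proof.
move=> Is maxM vM v0.
have VV := fsubset_verts_delete (cplx s) M.
have memV x := fsubsetP VV x.
have ptE F t : faces (cplx (del_state s M)) F -> supported F t ->
    cone_point (del_state s M) t = cone_point s t.
  move=> WF [_ tF]; apply: big_fset_incl => // x xV xnV; rewrite tF ?scale0r //.
  apply: contra xnV; apply/fsubsetP.
  by have [+ _ _ _] := delete_wcomplex (inv_wcomplex Is) maxM; apply.
split.
- exact: delete_wcomplex (inv_wcomplex Is) maxM.
- by move=> F [WF _]; apply: inv_unimodular Is F WF.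
- by move=> x xV; rewrite weight_delete //; apply: inv_den Is x (memV x xV).
- move=> F S t u WF WS tF uS; rewrite (ptE F) // (ptE S) //.
  by case: WF => WF _; case: WS => WS _; apply: (inv_cone Is) WF WS tF uS.
- by move=> x xV; apply: inv_cube Is x (memV x xV).
- by move=> x xV; apply: inv_hat Is x (memV x xV).
move=> F FV nF z z0 zF.
have [FM|FM] := pselect (F = M).
  by apply: lle_anti => //; rewrite -v0; apply: zF; rewrite FM.
apply: (inv_meet Is _ _ z0 zF); first exact: fsubset_trans FV VV.
by move=> WF; apply: nF; split.
Qed.

Lemma step_inv s s' : state_inv s -> step s s' -> state_inv s'.
Proof. by move=> Is [//|v w a|M v maxM vM]; [apply: sub_inv|apply: del_inv]. Qed.

End States.

(** * Geometric realization *)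

Lemma imfset_inj_in (K L : choiceType) (f : K -> L) (V F S : {fset K}) :
  {in V &, injective f} -> (F `<=` V)%fset -> (S `<=` V)%fset ->
  [fset f x | x in F]%fset = [fset f x | x in S]%fset -> F = S.
Proof.
move=> fI; wlog suff H : F S / (F `<=` V)%fset -> (S `<=` V)%fset ->
    [fset f x | x in F]%fset = [fset f x | x in S]%fset -> (F `<=` S)%fset.
  by move=> FV SV e; apply/eqP; rewrite eqEfsubset; apply/andP; split; apply: H.
move=> FV SV e; apply/fsubsetP => x xF.
have : f x \in [fset f x | x in S]%fset by rewrite -e; apply: in_imfset.
by case/imfsetP => y /= yS /fI -> //; [apply: (fsubsetP FV)|apply: (fsubsetP SV)].
Qed.

Section Geometry.
Variables (R : realType) (G : unitalLGroupType) (n : nat).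
Implicit Types (s : state G n) (F S M : {fset nat}) (v w a : nat) (x : 'rV[R]_n).
Local Notation state_inv := (state_inv R).
Local Notation rpt := (rpt R).

Definition simplex s F : {fset 'rV[rat]_n} := [fset pt s v | v in F]%fset.

Definition real_complex s : set {fset 'rV[rat]_n} :=
  [set simplex s F | F in faces (cplx s)].

Definition barycentric s F (t : nat -> R) (x : 'rV[R]_n) :=
  [/\ supported F t, \sum_(v <- F) t v = 1
    & x = \sum_(v <- F) t v *: rpt (pt s v)].

Section Invariant.
Variables (s : state G n) (Is : state_inv s).
Local Notation W := (cplx s).
Local Notation V := (verts (cplx s)).

Lemma pt_inj_in F : (F `<=` V)%fset -> {in F &, injective (pt s)}.
Proof. by move=> /fsubsetP FV v w /FV vV /FV wV; apply: (pt_inj Is). Qed.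

Lemma hull_simplexP F x : (F `<=` V)%fset ->
  hull R (simplex s F) x <-> exists t, barycentric s F t x.
Proof.
move=> FV; have ptI := pt_inj_in FV; split=> [[t [t0 t1 ->]]|[t [[t0 tF] t1 ->]]].
  exists (fun v => if v \in F then t (pt s v) else 0); split.
  - split=> v; last by move/negPf->.
    by case: ifP => // vF; apply: t0; apply: in_imfset.
  - rewrite -t1 big_imfset //=; apply: eq_big_seq => v.
    by move=> vF; rewrite vF.
  - rewrite big_imfset //=; apply: eq_big_seq => v.
    by move=> vF; rewrite vF.
(* In [hull] the weights are indexed by points; [u] transports [t] along the injective [pt s]. *)
pose u y := \sum_(v <- F) if pt s v == y then t v else 0.
have uE v : v \in F -> u (pt s v) = t v.
  move=> vF; rewrite -(sum_fset_delta t vF); apply: eq_big_seq => w wF.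
  by rewrite (inj_in_eq ptI).
exists u; split.
- move=> y _; rewrite /u; apply: sumr_ge0 => v _; case: ifP => // _; exact: t0.
- by rewrite big_imfset //= -t1; apply: eq_big_seq => v; apply: uE.
- by rewrite big_imfset //=; apply: eq_big_seq => v /uE ->.
Qed.

(** Dividing by the denominators turns barycentric weights into cone coefficients of the point
    lifted to height 1, which makes [inv_cone] applicable to them. *)
Lemma cone_point_barycentric F t x : (F `<=` V)%fset -> barycentric s F t x ->
  cone_point s (fun v => t v / (den (pt s v))%:R) = row_mx x (const_mx 1).
Proof.
move=> FV [[t0 tF] t1 ->]; rewrite /cone_point -(big_fset_incl _ FV) => [|v _ /tF ->].
  transitivity (\sum_(v <- F) t v *: row_mx (rpt (pt s v)) (const_mx 1 : 'rV[R]_1)).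
    apply: eq_bigr => v _; rewrite homogRE scalerA divfK //; exact: denr_neq0.
  apply/rowP => i; rewrite summxE [RHS]mxE.
  case: fintype.splitP => j ij; last first.
    rewrite mxE -[RHS]t1; apply: eq_bigr => v _; rewrite mxE.
    have -> : i = rshift n j by apply/val_inj.
    by rewrite row_mxEr mxE mulr1.
  have -> : i = lshift 1 j by apply/val_inj.
  by rewrite summxE; apply: eq_bigr => v _; rewrite [LHS]mxE row_mxEl [RHS]mxE.
by rewrite mul0r scale0r.
Qed.

Lemma barycentric_uniq F S t u x : faces W F -> faces W S ->
  barycentric s F t x -> barycentric s S u x -> t =1 u.
Proof.
move=> WF WS bF bS.
have FV := inv_faces_verts Is WF; have SV := inv_faces_verts Is WS.
have supp E r : barycentric s E r x -> supported E (fun v => r v / (den (pt s v))%:R).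
  by move=> [[r0 rE] _ _]; split=> v; [rewrite divr_ge0|move/rE->; rewrite mul0r].
have := inv_cone Is WF WS (supp _ _ bF) (supp _ _ bS).
rewrite (cone_point_barycentric FV bF) (cone_point_barycentric SV bS) => /(_ erefl) tu v.
by have := tu v => /(congr1 ( *%R^~ (den (pt s v))%:R)); rewrite !divfK ?denr_neq0.
Qed.

Lemma simplexI F S : (F `<=` V)%fset -> (S `<=` V)%fset ->
  (simplex s F `&` simplex s S)%fset = simplex s (F `&` S)%fset.
Proof.
move=> FV SV; apply/fsetP => y; rewrite inE; apply/andP/imfsetP => /=.
  move=> [/imfsetP[v /= vF ->] /imfsetP[w /= wS] vw]; exists v => //.
  rewrite inE vF /=; have -> // : v = w.
  by apply: (pt_inj Is) => //; [apply: (fsubsetP FV)|apply: (fsubsetP SV)].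
by move=> [v]; rewrite inE => /andP[vF vS] ->; split; apply: in_imfset.
Qed.

Lemma simplexS F S : (F `<=` S)%fset -> (simplex s F `<=` simplex s S)%fset.
Proof. by move=> FS; apply: subset_imfset; apply/fsubsetP. Qed.

Lemma sub_simplex F (T : {fset 'rV[rat]_n}) : (T `<=` simplex s F)%fset ->
  exists2 S, (S `<=` F)%fset & T = simplex s S.
Proof.
move=> TF; exists [fset v in F | pt s v \in T]%fset.
  by apply/fsubsetP => v; rewrite !inE => /andP[].
apply/fsetP => y; apply/idP/imfsetP => /= [yT|[v + ->]]; last first.
  by rewrite !inE => /andP[].
have /imfsetP[v /= vF yv] := fsubsetP TF y yT.
by exists v => //; rewrite !inE vF -yv.
Qed.

Lemma simplex_inj F S : (F `<=` V)%fset -> (S `<=` V)%fset ->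
  simplex s F = simplex s S -> F = S.
Proof. exact: imfset_inj_in (pt_inj Is). Qed.

Lemma mem_real_complex F : (F `<=` V)%fset -> real_complex s (simplex s F) <-> faces W F.
Proof.
move=> FV; split=> [[S WS e]|]; last by exists F.
by rewrite -(simplex_inj (inv_faces_verts Is WS) FV e).
Qed.

Lemma inv_regular : regular_complex R (real_complex s).
Proof.
split.
- apply: finite_image; apply: (@sub_finite_set _ _ [set` fpowerset V]).
    by move=> F /= /(inv_faces_verts Is) FV; rewrite fpowersetE.
  exact: finite_fset.
- move=> T [F WF <-]; have [B uB rB] := inv_unimodular Is WF.
  by exists B => // y /imfsetP[v /= vF ->]; apply: rB.
- move=> T E [F WF <-] /sub_simplex[S SF ->]; exists S => //.
  by have := inv_faces_sub Is WF SF.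
move=> _ _ [F WF <-] [S WS <-].
have FV := inv_faces_verts Is WF; have SV := inv_faces_verts Is WS.
rewrite simplexI //; apply/seteqP; split=> [x [Fx Sx]|x Ix]; last first.
  by split; apply: hull_mono Ix; apply: simplexS; [apply: fsubsetIl|apply: fsubsetIr].
have [t bF] := (hull_simplexP x FV).1 Fx; have [u bS] := (hull_simplexP x SV).1 Sx.
(* A common point has the same weights over both faces, so these are supported on the
   intersection. *)
have tu := barycentric_uniq WF WS bF bS.
apply/hull_simplexP; first by apply: fsubset_trans FV; apply: fsubsetIl.
have [[t0 tF] t1 ->] := bF; have [[u0 uS] _ _] := bS.
have tI v : v \in F -> v \notin (F `&` S)%fset -> t v = 0.
  by rewrite inE => -> /= vS; rewrite tu uS.
exists t; split.
- split=> // v; rewrite inE negb_and => /orP[/tF//|/uS]; by rewrite tu.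
- by rewrite (big_fset_incl _ (fsubsetIl F S)).
by rewrite -(big_fset_incl _ (fsubsetIl F S)) // => v vF vI; rewrite tI ?scale0r.
Qed.

Lemma inv_realization : realization R W (real_complex s) (pt s).
Proof.
split.
- exact: inv_regular.
- split.
  + move=> v /= vV; exists [fset v]%fset; first by have := inv_face1 Is vV.
    by apply/fsetP => y; rewrite !inE; apply/imfsetP/eqP => [[w /=]|->];
      [rewrite inE => /eqP->|exists v; rewrite ?inE].
  + by move=> v w; rewrite !inE => vV wV; apply: (pt_inj Is).
  + move=> y [F WF Fy]; have : y \in simplex s F by rewrite Fy inE.
    by case/imfsetP => v /= vF ->; exists v => //=; apply: (fsubsetP (inv_faces_verts Is WF)).
- exact: (inv_den Is).
by move=> F FV; symmetry; apply: mem_real_complex.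
Qed.

Lemma simplex_cube F x : (F `<=` V)%fset -> hull R (simplex s F) x -> cube R n x.
Proof.
move=> FV /(hull_simplexP x FV)[t [[t0 _] t1 ->]] i; rewrite summxE.
have le v : v \in F -> 0 <= rpt (pt s v) 0 i <= 1.
  move=> /(fsubsetP FV) vV; have /andP[p0 p1] := inv_cube Is vV i.
  by rewrite mxE ler0q p0 -(@rmorph1 _ _ (@ratr R)) ler_rat.
apply/andP; split.
  rewrite big_seq; apply: sumr_ge0 => v /le /andP[p0 _].
  by rewrite mxE mulr_ge0.
rewrite -[leRHS]t1 big_seq [leRHS]big_seq; apply: ler_sum => v /le /andP[_ p1].
by rewrite mxE ler_piMr.
Qed.

End Invariant.
End Geometry.

(** * Combinatorial steps as blow-ups and deletions *)

Section Steps.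
Variables (R : realType) (G : unitalLGroupType) (n : nat).
Implicit Types (s : state G n) (F S M : {fset nat}) (v w a : nat) (x : 'rV[R]_n).
Local Notation rpt := (rpt R).

Section Subdivision.
Variables (s : state G n) (v w a : nat).
Hypotheses (Is : state_inv R s) (sub : subdivisible (cplx s) v w a).
Local Notation W := (cplx s).
Local Notation V := (verts (cplx s)).
Local Notation s' := (sub_state s v w a).
Local Notation wcW := (inv_wcomplex Is).
Local Notation e := (mediant (pt s v) (pt s w)).

Let vV : v \in V. Proof. exact: subdivisible_vertl wcW sub. Qed.
Let wV : w \in V. Proof. exact: subdivisible_vertr wcW sub. Qed.
Let vw : v != w. Proof. exact: subdivisible_neq sub. Qed.
Let vwF : faces W [fset v; w]%fset. Proof. by case: sub. Qed.
Let FV F : faces W F -> (F `<=` V)%fset. Proof. exact: (inv_faces_verts Is). Qed.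

(** Barycentric weights of the mediant: each end counts in proportion to its denominator. *)
Definition mediant_coef : nat -> R := fun x : nat =>
  if (x == v) || (x == w) then
    (den (pt s x))%:R / ((den (pt s v))%:R + (den (pt s w))%:R) else 0.

Lemma barycentric_mediant : barycentric s [fset v; w]%fset mediant_coef (rpt e).
Proof.
set d : R := (den (pt s v))%:R + (den (pt s w))%:R.
have d0 : 0 < d by rewrite addr_gt0 // ltr0n den_gt0.
have sum2 (U : zmodType) (f : nat -> U) : \sum_(x <- [fset v; w]%fset) f x = f v + f w.
  by rewrite big_fsetU1 ?inE // big_seq_fset1.
have cv : mediant_coef v = (den (pt s v))%:R / d by rewrite /mediant_coef eqxx.
have cw : mediant_coef w = (den (pt s w))%:R / d by rewrite /mediant_coef eqxx orbT.
split.
- split=> x; rewrite /mediant_coef; first by case: ifP => // _; rewrite divr_ge0 // ltW.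
  by rewrite !inE => /negPf ->.
- by rewrite sum2 cv cw -mulrDl divff // gt_eqF.
rewrite sum2 cv cw; apply/rowP => i; rewrite !mxE rmorphM fmorphV !rmorphD !rmorphM /=.
by rewrite !ratr_nat -/d mulrDr !mulrA ![_ / d]mulrC.
Qed.

(** The mediant has nonzero weight at both ends, so by uniqueness of the weights a face can contain
    it only by containing the edge. This makes the geometric conditions in [blowup]
    combinatorial. *)
Lemma hull_mediant F : faces W F ->
  hull R (simplex s F) (rpt e) <-> ([fset v; w] `<=` F)%fset.
Proof.
move=> WF; split=> [/(hull_simplexP Is _ (FV WF))[t bF]|/(simplexS s) vwS]; last first.
  apply: hull_mono vwS _ _; apply/(hull_simplexP Is _ (FV vwF)).
  by exists mediant_coef; apply: barycentric_mediant.
have tc := barycentric_uniq Is WF vwF bF barycentric_mediant.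
have [[_ tF] _ _] := bF.
have d0 (x : nat) : (den (pt s x))%:R / ((den (pt s v))%:R + (den (pt s w))%:R) != 0 :> R.
  by rewrite -natrD mulf_neq0 ?invr_neq0 // pnatr_eq0 -lt0n ?addn_gt0 den_gt0.
rewrite fsub2; apply/andP; split; apply: contraTT isT => xF.
  by have := d0 v; have := tF _ xF; rewrite tc /mediant_coef eqxx /= => ->; rewrite eqxx.
by have := d0 w; have := tF _ xF; rewrite tc /mediant_coef eqxx orbT /= => ->; rewrite eqxx.
Qed.

Lemma simplex_sub_old F : a \notin F -> simplex s' F = simplex s F.
Proof.
move=> aF; apply: eq_in_imfset => // x xF /=.
by case: eqP => // xa; rewrite -xa xF in aF.
Qed.

Lemma simplex_sub_new F : a \in F -> simplex s' F = (e |` simplex s (F `\ a))%fset.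
Proof.
move=> aF; apply/fsetP => y; rewrite !inE; apply/imfsetP/orP => /=.
  move=> [x xF ->]; case: (eqVneq x a) => [_|xa]; first by left.
  by right; apply: in_imfset; rewrite !inE xa.
case=> [/eqP->|/imfsetP[x /=]]; first by exists a; rewrite ?eqxx.
by rewrite !inE => /andP[/negPf xa xF] ->; exists x; rewrite ?xa.
Qed.

Lemma face_sub_new F S : a \in F -> faces W S -> (F `<=` a |` S)%fset -> 
  (F `\ a `<=` S)%fset.
Proof.
move=> aF WS /fsubsetP FS; apply/fsubsetP => x; rewrite !inE => /andP[/negPf xa xF].
by have := FS x xF; rewrite !inE xa.
Qed.

Lemma real_complex_sub : real_complex s' = blowup R (real_complex s) e.
Proof.
have av : (v == a) = false := subdivisible_fresh sub vV.
have aw : (w == a) = false := subdivisible_fresh sub wV.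
have aFW F : faces W F -> a \notin F.
  by move=> WF; apply: contra (subdivisible_notin sub); apply/fsubsetP/FV.
apply/seteqP; split=> T.
  move=> [F WF <-]; have [aF|aF] := boolP (a \in F).
    have /(faces_subdivision_new wcW sub aF) [S [WS vS wS FS nF]] := WF.
    right; exists (simplex s S), (simplex s (F `\ a)%fset).
    have FaS := face_sub_new aF WS FS.
    split; [by exists S| | exact: simplexS| |exact: simplex_sub_new].
      by apply/(hull_mediant WS); rewrite fsub2 vS.
    move/(hull_mediant (inv_faces_sub Is WS FaS)); rewrite fsub2 !inE av aw /= => vwF'.
    by move: nF; rewrite fsub2 vwF'.
  have /(faces_subdivision_old wcW sub aF) [WF' nF] := WF.
  left; split; first by rewrite simplex_sub_old //; exists F.
  by rewrite simplex_sub_old // => /(hull_mediant WF'); apply/negP.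
case=> [[[F WF <-] nF]|[_ [E [[S WS <-] eS /sub_simplex[F FS ->] nF ->]]]].
  exists F; last by rewrite simplex_sub_old ?aFW.
  apply/(faces_subdivision_old wcW sub (aFW _ WF)); split=> //.
  by apply/negP => /(hull_mediant WF).
have WF := inv_faces_sub Is WS FS.
have aF : a \in (a |` F)%fset by rewrite fset1U1.
have Fa : ((a |` F) `\ a)%fset = F.
  by apply/fsetP => x; rewrite !inE; case: eqP => //= ->; rewrite (negPf (aFW _ WF)).
exists (a |` F)%fset; last by rewrite simplex_sub_new // Fa.
apply/(faces_subdivision_new wcW sub aF); exists S.
have /(hull_mediant WS) := eS; rewrite fsub2 => /andP[vS wS]; split=> //.
  exact: fsetUS.
rewrite fsub2 !inE av aw /=; apply/negP => vwF'; apply: nF.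
by apply/(hull_mediant WF); rewrite fsub2.
Qed.

Lemma realization_step_sub : realization_step R W (cplx s') (real_complex s)
  (real_complex s') (pt s) (pt s').
Proof.
apply: Or32; exists v, w, a, e; split=> //.
- split; last exact: homog_new Is sub.
  have := (hull_mediant vwF).2 (fsubset_refl _); congr (hull R _ _).
  apply/fsetP => y; rewrite !inE; apply/imfsetP/orP => /=.
    by move=> [x]; rewrite !inE => /orP[/eqP->|/eqP->] ->; [left|right].
  by case=> /eqP->; [exists v|exists w]; rewrite ?inE ?eqxx ?orbT.
- exact: real_complex_sub.
split; first by rewrite /= eqxx.
by move=> x xV; apply: pt_sub_old sub x xV.
Qed.

End Subdivision.

Lemma realization_step_delete s M : state_inv R s -> maximal_face (cplx s) M ->
  realization_step R (cplx s) (cplx (del_state s M)) (real_complex s)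
    (real_complex (del_state s M)) (pt s) (pt s).
Proof.
move=> Is maxM; apply: Or31; exists M; split=> //.
apply/seteqP; split=> T.
  move=> [F [WF FM] <-]; split; first by exists F.
  move=> /= e; apply: FM; apply: (simplex_inj Is) e; apply: (inv_faces_verts Is) => //.
  by case: maxM.
by move=> [[F WF <-] FM]; exists F => //; split=> // FM'; apply: FM; rewrite FM'.
Qed.

Lemma step_realization s s' : state_inv R s -> step s s' ->
  realization_step R (cplx s) (cplx s') (real_complex s) (real_complex s')
    (pt s) (pt s').
Proof.
move=> Is [|v w a sub|M v maxM _ _].
- exact: Or33.
- exact: realization_step_sub.
exact: realization_step_delete.
Qed.

(** Besides the decrease of the supports, this gives that an affine formula valid on an old simplex
    persists on the new ones. *)
Lemma step_hull s s' F : state_inv R s -> step s s' -> faces (cplx s') F ->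
  exists2 S, faces (cplx s) S & hull R (simplex s' F) `<=` hull R (simplex s S).
Proof.
move=> Is [|v w a sub|M v _ _ _]; last by move=> [WF _]; exists F.
  by move=> WF; exists F.
have wcW := inv_wcomplex Is.
move=> WF; have [aF|aF] := boolP (a \in F).
  have /(faces_subdivision_new wcW sub aF) [S [WS vS wS FS _]] := WF.
  exists S => //; rewrite simplex_sub_new //; apply: hull_cone.
    by apply/(hull_mediant Is sub WS); rewrite fsub2 vS.
  exact: simplexS (face_sub_new aF WS FS).
have /(faces_subdivision_old wcW sub aF) [WF' _] := WF.
by exists F => //; rewrite simplex_sub_old.
Qed.

End Steps.

(** * Fair sequences of steps *)

Section FairSequence.
Variables (T : Type) (next : T -> T -> Prop).

Inductive can_reach (P : T -> Prop) (s : T) : Prop :=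
| reach_now : P s -> can_reach P s
| reach_next s' : next s s' -> can_reach P s' -> can_reach P s.

Lemma can_reach_trans (P Q : T -> Prop) s :
  can_reach P s -> (forall s', P s' -> can_reach Q s') -> can_reach Q s.
Proof.
by move=> + PQ; elim=> {s} [s /PQ//|s s' ss' _]; apply: reach_next.
Qed.

Fixpoint reach_in (P : T -> Prop) m s : Prop :=
  if m is m'.+1 then exists2 s', next s s' & reach_in P m' s' else P s.

(** Tasks are completed in order, and each switch of task costs one idle step; hence task [k] is
    completed no earlier than stage [k]. A condition common to all tasks therefore holds at
    arbitrarily late stages. *)
Lemma fair_sequence (I : T -> Prop) (P : nat -> T -> Prop) s0 :
  (forall s, next s s) -> (forall s s', I s -> next s s' -> I s') ->
  (forall k s, I s -> can_reach (P k) s) -> I s0 ->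
  exists sigma : nat -> T, [/\ sigma 0%N = s0,
    forall j, next (sigma j) (sigma j.+1)
    & forall k, exists2 j, (k <= j)%N & P k (sigma j)].
Proof.
move=> refl Istep reachP I0.
have reach k s : I s -> exists m, reach_in (P k) m s.
  move=> /(reachP k); elim=> {s} [s Ps|s s' ss' _ [m Pm]]; first by exists 0%N.
  by exists m.+1, s'.
(* a configuration is the current state, the index of the current task, and a
   number of steps after which the task can be completed *)
pose A := {c : T * nat * nat | I c.1.1 /\ reach_in (P c.1.2) c.2 c.1.1}.
have /choice[f fE] : forall x : A, exists y : A, next (sval x).1.1 (sval y).1.1 /\
    ((sval x).2 = 0%N /\ (sval y).1.2 = (sval x).1.2.+1 \/
     (sval x).2 = (sval y).2.+1 /\ (sval y).1.2 = (sval x).1.2).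
  move=> -[[[s k] [|m]] /= [Is Rs]].
    have [m Rm] := reach k.+1 s Is.
    by exists (exist _ (s, k.+1, m) (conj Is Rm)); split; [exact: refl|left].
  have [s' ss' Rs'] := Rs.
  by exists (exist _ (s', k, m) (conj (Istep _ _ Is ss') Rs')); split=> //; right.
have [m0 R0] := reach 0%N s0 I0.
pose x0 : A := exist _ (s0, 0%N, m0) (conj I0 R0).
pose c j := sval (iter j f x0).
exists (fun j => (c j).1.1); split=> // [j|k]; first exact: (fE (iter j f x0)).1.
have wait j m : (c j).2 = m -> exists2 i, (j <= i)%N & (c i).1.2 = (c j).1.2 /\ (c i).2 = 0%N.
  elim: m j => [|m IH] j cj; first by exists j.
  have [_ [[e _]|[e ek]]] := fE (iter j f x0); first by rewrite /c e in cj.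
  have [|i ji [ik i0]] := IH j.+1; first by move: cj; rewrite /c e => -[].
  by exists i; [apply: ltnW|rewrite ik i0; split].
suff [j kj [ck c0]] : exists2 j, (k <= j)%N & (c j).1.2 = k /\ (c j).2 = 0%N.
  exists j => //; have := (svalP (iter j f x0)).2.
  by rewrite -/(c j) ck c0.
elim: k => [|k [j kj [ck c0]]]; first by have [i _ [ci ci0]] := wait 0%N _ erefl; exists i.
have [_ [[_ ek]|[e _]]] := fE (iter j f x0); last by rewrite /c e in c0.
have [i ji [ik i0]] := wait j.+1 _ erefl.
by exists i; [apply: leq_ltn_trans kj ji|split=> //; rewrite ik /c ek -/(c j) ck].
Qed.

End FairSequence.

(** * Reaching sign coherence and nonzero hats *)

Section Tasks.
Variables (R : realType) (G : unitalLGroupType) (n : nat).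
Implicit Types (s : state G n) (F S M : {fset nat}) (v w a x y : nat).
Implicit Types (l : 'rV[int]_n * int).
Local Notation inv := (@state_inv R G n).

Definition vval l s v : int := linval l (homog (pt s v)).

Definition bad_edge l s v w :=
  [/\ faces (cplx s) [fset v; w]%fset, 0 < vval l s v & vval l s w < 0].

Definition sign_coherent l s := forall v w, ~ bad_edge l s v w.

Lemma fresh_vertex (A : {fset nat}) : exists a, a \notin A.
Proof.
exists (\max_(x <- A) x).+1; apply/negP => aA.
by have := @leq_bigmax_seq _ (enum_fset A) xpredT id _ aA isT; rewrite ltnn.
Qed.

Section Subdivision.
Variables (s : state G n) (v w a : nat) (l : 'rV[int]_n * int).
Hypotheses (Is : inv s) (sub : subdivisible (cplx s) v w a).
Local Notation s' := (sub_state s v w a).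

Lemma vval_sub_old x : x \in verts (cplx s) -> vval l s' x = vval l s x.
Proof. by move=> xV; rewrite /vval (pt_sub_old sub). Qed.

Lemma vval_sub_new : vval l s' a = vval l s v + vval l s w.
Proof. by rewrite /vval pt_sub_new (homog_new Is sub) linvalD. Qed.

(** The subdivided edge is gone. For a new edge at [a], the other end forms faces with both [v] and
    [w]; the values on these old edges control the value difference on the new one. *)
Lemma bad_edge_sub x y : bad_edge l s' x y ->
  [\/ [/\ bad_edge l s x y, (x, y) != (v, w), vval l s' x = vval l s x
        & vval l s' y = vval l s y],
      [/\ x = a, vval l s' y = vval l s y, faces (cplx s) [fset v; y]%fset
        & faces (cplx s) [fset w; y]%fset]
    | [/\ y = a, vval l s' x = vval l s x, faces (cplx s) [fset x; v]%fset
        & faces (cplx s) [fset x; w]%fset]].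
Proof.
have wcW := inv_wcomplex Is.
move=> [WF x0 y0]; have xy : x != y by apply: contraTneq x0 => ->; rewrite -leNgt ltW.
have memF : x \in [fset x; y]%fset /\ y \in [fset x; y]%fset by rewrite !inE !eqxx orbT.
have [aF|aF] := boolP (a \in [fset x; y]%fset).
  have /(faces_subdivision_new wcW sub aF) [S [WS vS wS FS _]] := WF.
  have face2 u u' : u \in S -> u' \in S -> faces (cplx s) [fset u; u']%fset.
    by move=> uS u'S; apply: (inv_faces_sub Is WS); rewrite fsub2 uS.
  have SV u : u \in S -> u \in verts (cplx s) by apply/fsubsetP/(inv_faces_verts Is WS).
  have mem_S u : u \in [fset x; y]%fset -> u != a -> u \in S.
    by move=> /(fsubsetP FS); rewrite !inE => /orP[->|].
  move: aF; rewrite !inE => /orP[/eqP ax|/eqP ay].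
    have yS : y \in S by apply: mem_S memF.2 _; rewrite ax eq_sym.
    by apply: Or32; split; rewrite ?vval_sub_old ?SV //; apply: face2.
  have xS : x \in S by apply: mem_S memF.1 _; rewrite ay.
  by apply: Or33; split; rewrite ?vval_sub_old ?SV //; apply: face2.
have /(faces_subdivision_old wcW sub aF) [WF' nvw] := WF.
have FV := fsubsetP (inv_faces_verts Is WF').
have xE := vval_sub_old (FV _ memF.1); have yE := vval_sub_old (FV _ memF.2).
apply: Or31; split; rewrite // ?xE ?yE //.
  by split; rewrite -?xE -?yE.
by apply: contra nvw => /eqP[-> ->].
Qed.

End Subdivision.

(** Since [l a = l v + l w], a positive value at [a] forces one at [v] or [w], which makes a bad
    edge with the same negative neighbour before the step; dually for a negative value. *)
Lemma step_sign_coherent l s s' : inv s -> step s s' ->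
  sign_coherent l s -> sign_coherent l s'.
Proof.
move=> Is [//|v w a sub|M v maxM _ _] good x y; last first.
  by move=> [[WF _] x0 y0]; apply: (good x y).
move=> bad; have [_ x0 y0] := bad.
case: (bad_edge_sub Is sub bad) => [[]||].
- by move=> /good.
- move=> [xa yE vy wy]; rewrite yE in y0.
  have [v0|v0] := ltP 0 (vval l s v); first by apply: (good v y).
  have [w0|w0] := ltP 0 (vval l s w); first by apply: (good w y).
  by move: x0; rewrite xa (vval_sub_new l Is sub) ltNge -[leRHS]addr0 lerD.
move=> [ya xE xv xw]; rewrite xE in x0.
have [v0|v0] := ltP (vval l s v) 0; first by apply: (good x v).
have [w0|w0] := ltP (vval l s w) 0; first by apply: (good x w).
by move: y0; rewrite ya (vval_sub_new l Is sub) ltNge addr_ge0.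
Qed.

(* Subdividing a bad edge [{v, w}] with [l v - l w] maximal only creates bad
   edges with strictly smaller difference, since [l a = l v + l w]. *)
Lemma reach_sign_coherent_bounded l (m : nat) s : inv s ->
  (forall v w, bad_edge l s v w -> vval l s v - vval l s w <= m%:Z) ->
  can_reach (@step G n) (fun s' => inv s' /\ sign_coherent l s') s.
Proof.
elim: m s => [|m IHm] s Is bound.
  apply: reach_now; split=> // v w bad; have := bound v w bad.
  by case: bad => _; lia.
(* An inner induction runs on the number of bad edges attaining the bound [m.+1]: subdividing one of
   them removes it and adds none. *)
pose top s v w := bad_edge l s v w /\ vval l s v - vval l s w = m.+1%:Z.
pose B s := [fset p in (verts (cplx s) `*` verts (cplx s))%fset | `[< top s p.1 p.2 >]]%fset.
have [k] := ubnP #|` B s|; elim: k s Is bound => // k IHk s Is bound Bk.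
have [[v [w [bad vwm]]]|none] := pselect (exists v w, top s v w); last first.
  apply: IHm => // v w bad; have := bound v w bad.
  have : vval l s v - vval l s w <> m.+1%:Z by move=> e; apply: none; exists v, w.
  by lia.
have [a aV] := fresh_vertex (verts (cplx s)).
have [WF v0 w0] := bad.
have sub : subdivisible (cplx s) v w a.
  by split=> //; apply: contraTneq v0 => ->; rewrite -leNgt ltW.
have key x y : bad_edge l (sub_state s v w a) x y ->
    vval l (sub_state s v w a) x - vval l (sub_state s v w a) y <= m%:Z \/
    [/\ bad_edge l s x y, (x, y) != (v, w), vval l (sub_state s v w a) x = vval l s x
        & vval l (sub_state s v w a) y = vval l s y].
  move=> bad'; have [_ x0 y0] := bad'.
  case: (bad_edge_sub Is sub bad') => [|[xa yE vy wy]|[ya xE xv xw]]; first by right.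
    left; rewrite yE in y0 *; have := bound v y (And3 vy v0 y0).
    by rewrite xa (vval_sub_new l Is sub); lia.
  left; rewrite xE in x0 *; have := bound x w (And3 xw x0 w0).
  by rewrite ya (vval_sub_new l Is sub); lia.
apply: reach_next (step_sub sub) _; apply: IHk.
- exact: sub_inv.
- move=> x y /key[|[bad' _ -> ->]]; last exact: bound.
  by lia.
have BE s1 p : inv s1 -> (p \in B s1) <-> top s1 p.1 p.2.
  move=> I1; rewrite !inE /= andbC; split=> [/andP[/asboolP//]|tp].
  rewrite (asboolT tp) /=; case: tp => -[Wp _ _] _.
  by move: (inv_faces_verts I1 Wp); rewrite fsub2.
have Bvw : (v, w) \in B s by apply/BE.
have BB : (B (sub_state s v w a) `<=` B s `\ (v, w))%fset.
  apply/fsubsetP => -[x y] /(BE _ _ (sub_inv Is sub)) [/= bad' e].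
  rewrite in_fsetD1; case: (key x y bad') => [|[bad'' ne xE yE]]; first by lia.
  by rewrite ne /=; apply/BE => //; split; rewrite //= -xE -yE.
rewrite (cardfsD1 (v, w)) Bvw add1n ltnS in Bk.
exact: leq_ltn_trans (fsubset_leq_card BB) Bk.
Qed.

Lemma reach_sign_coherent l s : inv s ->
  can_reach (@step G n) (fun s' => inv s' /\ sign_coherent l s') s.
Proof.
move=> Is; pose N := (\sum_(v <- verts (cplx s)) `|vval l s v|)%N.
have le v : v \in verts (cplx s) -> (`|vval l s v| <= N)%N.
  by move=> vV; rewrite /N (big_fsetD1 v) //= leq_addr.
apply: (@reach_sign_coherent_bounded l (N + N)) => // v w [/(inv_faces_verts Is)].
by rewrite fsub2 => /andP[/le + /le]; lia.
Qed.

Definition clean s := forall v, v \in verts (cplx s) -> hat s v <> 0.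

(** Deleting maximal faces through a vertex of zero hat terminates because the number of faces
    drops. [Q] carries along what has already been achieved, such as sign coherence. *)
Lemma reach_clean (Q : state G n -> Prop) s :
  (forall s1, Q s1 -> inv s1) -> (forall s1 s2, Q s1 -> step s1 s2 -> Q s2) ->
  Q s -> can_reach (@step G n) (fun s' => Q s' /\ clean s') s.
Proof.
move=> Qinv Qstep.
pose B s := [fset F in fpowerset (verts (cplx s)) | `[< faces (cplx s) F >]]%fset.
have [k] := ubnP #|` B s|; elim: k s => // k IHk s Bk Qs.
have Is := Qinv s Qs.
have [cl|/existsNP[v /not_implyP[vV /contrapT v0]]] := pselect (clean s).
  exact: reach_now.
(* A face through [v] of largest cardinality is maximal. *)
pose P m := `[< exists F, [/\ faces (cplx s) F, v \in F & #|` F| = m] >].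
have exP : exists m, P m.
  exists 1%N; apply/asboolP; exists [fset v]%fset; rewrite cardfs1 inE eqxx.
  by split=> //; have := inv_face1 Is vV.
have boundP m : P m -> (m <= #|` verts (cplx s)|)%N.
  by move=> /asboolP[F [/(inv_faces_verts Is)/fsubset_leq_card + _ <-]].
case: (ex_maxnP exP boundP) => m /asboolP[F [WF vF Fm]] maxm.
have maxF : maximal_face (cplx s) F.
  split=> // E WE FE; apply/eqP; rewrite eq_sym eqEfcard FE Fm.
  by apply: maxm; apply/asboolP; exists E; split=> //; apply: (fsubsetP FE).
have st := step_del maxF vF v0.
apply: (reach_next st); apply: IHk; last exact: (Qstep s).
have BF : F \in B s.
  by rewrite !inE /= fpowersetE (inv_faces_verts Is WF) (asboolT WF).
have BB : (B (del_state s F) `<=` B s `\ F)%fset.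
  apply/fsubsetP => E; rewrite in_fsetD1 !inE /= !fpowersetE.
  move=> /andP[EV /asboolP[WE EF]]; apply/and3P; split; last exact/asboolP.
    by apply/eqP.
  exact: fsubset_trans EV (fsubset_verts_delete _ _).
rewrite (cardfsD1 F) BF add1n ltnS in Bk.
exact: leq_ltn_trans (fsubset_leq_card BB) Bk.
Qed.

End Tasks.

(** * Linearity of McNaughton functions *)

Section Linearity.
Variables (R : realType) (n : nat).
Implicit Types (x y : 'rV[R]_n) (l m : 'rV[int]_n * int).

(* equal to [0] outside the cube *)
Definition ext (f : cube R n -> R) x : R := oapp f 0 (insub x).

Lemma extE (f : cube R n -> R) (x : cube R n) : ext f (val x) = f x.
Proof. by rewrite /ext valK. Qed.

Definition cube_pt x (cx : cube R n x) : cube R n := exist _ x (mem_set cx).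

Lemma ext_in (f : cube R n -> R) x (cx : cube R n x) : ext f x = f (cube_pt cx).
Proof. by rewrite -extE. Qed.

(** Clamping the parameter keeps the segment in the cube for every real [t], so the path is
    continuous on all of [R] and no subspace topology is needed for the intermediate value
    theorem. *)
Definition clamp01 (t : R) : R := Num.max 0 (Num.min 1 t).

Lemma clamp01_itv t : 0 <= clamp01 t <= 1.
Proof. by rewrite le_max lexx ge_max ler01 ge_min lexx. Qed.

Lemma clamp01_id t : 0 <= t <= 1 -> clamp01 t = t.
Proof. by case/andP => t0 t1; rewrite /clamp01 (min_idPr t1); apply/max_idPr. Qed.

Lemma clamp01_continuous : continuous clamp01.
Proof.
move=> t; apply: continuous_max; first exact: cst_continuous.
by apply: continuous_min; first exact: cst_continuous.
Qed.

Lemma cube_convex x y (t : R) : cube R n x -> cube R n y -> 0 <= t <= 1 ->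
  cube R n ((1 - t) *: x + t *: y).
Proof.
move=> cx cy /andP[t0 t1] i; rewrite !mxE.
have /andP[x0 x1] := cx i; have /andP[y0 y1] := cy i.
by apply/andP; split; nra.
Qed.

Lemma segment_continuous (f : cube R n -> R) x y : continuous f ->
  cube R n x -> cube R n y ->
  continuous (fun t => ext f ((1 - clamp01 t) *: x + clamp01 t *: y)).
Proof.
move=> cf cx cy; pose h t := (1 - clamp01 t) *: x + clamp01 t *: y.
have hc t : cube R n (h t) by apply: cube_convex => //; apply: clamp01_itv.
pose g t := cube_pt (hc t).
have hcont : continuous h.
  move=> t; apply: cvgD; apply: cvgZr_tmp; last exact: clamp01_continuous.
  by apply: cvgB; [exact: cvg_cst|exact: clamp01_continuous].
have gcont : continuous g by apply: continuous_comp_initial.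
rewrite (_ : (fun t => _) = f \o g); last first.
  by apply/funext => t; rewrite -/(h t) (ext_in _ (hc t)).
by move=> t; apply: continuous_comp; [apply: gcont|apply: cf].
Qed.

Lemma affineZ_segment l x y t : affineZ l ((1 - t) *: x + t *: y) =
  (1 - t) * affineZ l x + t * affineZ l y :> R.
Proof.
have := @affineZ_sum R n l bool [:: true; false] (fun b => if b then 1 - t else t)
  (fun b => if b then x else y).
by rewrite !big_cons !big_nil /= !addr0; apply; rewrite subrK.
Qed.

(* Along the segment from [x] to [y] the value [f - l] ranges in a finite set of
   affine functions which vanish identically or stay away from [0] before [y],
   so by the intermediate value theorem it cannot leave [0]. *)
Lemma piece_propagates (f : cube R n -> R) (r : seq ('rV[int]_n * int)) l x y :
  continuous f -> cube R n x -> cube R n y ->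
  (forall z : cube R n, exists2 m, m \in r & f z = affineZ m (val z)) ->
  (forall m, m \in r ->
    [\/ affineZ m x = affineZ l x /\ affineZ m y = affineZ l y,
        affineZ l x < affineZ m x /\ affineZ l y <= affineZ m y
      | affineZ m x < affineZ l x /\ affineZ m y <= affineZ l y]) ->
  ext f x = affineZ l x -> ext f y = affineZ l y.
Proof.
move=> cf cx cy fr rl fx.
(* As [r] is finite, the pieces that differ from [l] at [x] do so by a uniform gap [d]. *)
have [d d0 dP] : exists2 d : R, 0 < d & forall m, m \in r ->
    affineZ m x = affineZ l x \/ d <= `|affineZ m x - affineZ l x|.
  elim: (r) => [|m q [d d0 IH]]; first by exists 1.
  have [e|ne] := eqVneq (affineZ m x) (affineZ l x : R).
    by exists d => // m'; rewrite inE => /predU1P[->|/IH//]; left.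
  exists (Num.min d `|affineZ m x - affineZ l x|).
    by rewrite lt_min d0 normr_gt0 subr_eq0.
  move=> m'; rewrite inE => /predU1P[->|/IH[->|dm]]; [right|by left|right].
    by rewrite ge_min lexx orbT.
  by rewrite ge_min dm.
apply: contrapT => fy.
pose g t := ext f ((1 - clamp01 t) *: x + clamp01 t *: y) -
  ((1 - clamp01 t) * affineZ l x + clamp01 t * affineZ l y).
have gcont : continuous g.
  move=> t; apply: cvgB; first exact: segment_continuous.
  apply: cvgD; apply: cvgMr_tmp; last exact: clamp01_continuous.
  by apply: cvgB; [exact: cvg_cst|exact: clamp01_continuous].
(* At a parameter [t < 1] either [g t = 0] or [g t] has absolute value at least [(1 - t) * d]; the
   barrier [(1 - t) * (d / 2)] lies strictly between, so [k] has no zero there. *)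
pose k (t : R) : R := `|g t| - (1 - t) * (d / 2).
have kcont : continuous k.
  move=> t; apply: cvgB; first by apply: cvg_norm; exact: gcont.
  by apply: cvgMr_tmp; apply: cvgB; [exact: cvg_cst|exact: cvg_id].
have k0 : k 0 < 0.
  rewrite /k /g clamp01_id ?lexx ?ler01 // subr0 !scale1r scale0r addr0 fx.
  by rewrite !mul1r mul0r addr0 subrr normr0 sub0r oppr_lt0 divr_gt0.
have k1 : 0 < k 1.
  rewrite /k /g clamp01_id ?lexx ?ler01 // subrr scale0r scale1r add0r.
  by rewrite !mul0r subr0 add0r mul1r normr_gt0 subr_eq0; apply/eqP.
have [t t01 kt] : exists2 t, t \in `[0, 1] & k t = 0.
  apply: IVT => //; first by apply: continuous_subspaceT.
  by rewrite ge_min le_max ltW ?k0 //= (ltW k1) orbT.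
have {}t01 : 0 <= t <= 1 by move: t01; rewrite in_itv.
have t1 : t < 1.
  rewrite lt_neqAle; case/andP: t01 => _ ->; rewrite andbT.
  by apply: contraTneq k1 => <-; rewrite kt ltxx.
have cz := cube_convex cx cy t01.
have [m mr fm] := fr (cube_pt cz).
have gt : g t = (1 - t) * (affineZ m x - affineZ l x) + t * (affineZ m y - affineZ l y).
  rewrite /g clamp01_id // (ext_in f cz) fm /= affineZ_segment.
  by ring.
have kt' : `|g t| = (1 - t) * (d / 2) by apply/eqP; rewrite -subr_eq0; apply/eqP.
have /andP[t0 _] := t01.
have := dP m mr; have := rl m mr; rewrite gt in kt'.
case=> [[ex ey] _|[lx ly]|[lx ly]].
- move: kt'; rewrite ex ey !subrr !mulr0 addr0 normr0 => /esym/eqP.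
  by rewrite mulf_eq0 gt_eqF ?subr_gt0 //= gt_eqF // divr_gt0.
- case=> [e|]; first by rewrite e ltxx in lx.
  rewrite ger0_norm ?subr_ge0 ?(ltW lx) // => dx.
  move: kt'; rewrite ger0_norm; last first.
    by rewrite addr_ge0 // mulr_ge0 // subr_ge0 // ltW.
  by nra.
- case=> [e|]; first by rewrite e ltxx in lx.
  rewrite ler0_norm ?subr_le0 ?(ltW lx) // => dx.
  move: kt'; rewrite ler0_norm; last first.
    by rewrite -oppr_ge0 opprD -!mulrN !opprB addr_ge0 // mulr_ge0 // subr_ge0 // ltW.
  by nra.
Qed.

Variable G : unitalLGroupType.
Implicit Types (s : state G n) (F : {fset nat}).

Definition linear_on (f : cube R n -> R) s := forall F, faces (cplx s) F ->
  exists l, forall x, hull R (simplex s F) x -> ext f x = affineZ l x.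

Lemma step_linear_on f s s' : state_inv R s -> step s s' ->
  linear_on f s -> linear_on f s'.
Proof.
move=> Is st lin F WF; have [S WS FS] := step_hull Is st WF.
by have [l lP] := lin S WS; exists l => x /FS/lP.
Qed.

Lemma sign_coherent_vertices l s F : faces (cplx s) F ->
  (forall v w, v \in F -> w \in F -> faces (cplx s) [fset v; w]%fset) ->
  sign_coherent l s ->
  (forall v, v \in F -> 0 <= affineZ l (rpt R (pt s v))) \/
  (forall v, v \in F -> affineZ l (rpt R (pt s v)) <= 0).
Proof.
move=> WF pairs coh.
have d0 v : 0 < (den (pt s v))%:R :> R by rewrite ltr0n den_gt0.
have [[w [wF w0]]|none] := pselect (exists w, w \in F /\ vval l s w < 0); [right|left].
  move=> v vF; rewrite -(pmulr_rle0 _ (d0 v)) affineZ_homog lerz0 leNgt.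
  by apply/negP => v0; apply: (coh v w); split=> //; apply: pairs.
move=> v vF; rewrite -(pmulr_rge0 _ (d0 v)) affineZ_homog ler0z leNgt.
by apply/negP => v0; apply: none; exists v.
Qed.

(** The piece [l] active at the barycentre [x] of [F] is shown to hold on all of [F]. A difference
    [m - l] does not change sign on the vertices, and [x] has positive weight at each of them: so
    [m - l] vanishes on [F], or it is nonzero at [x] and keeps that sign weakly throughout, as
    [piece_propagates] requires. *)
Lemma sign_coherent_linear f s (r : seq ('rV[int]_n * int)) : state_inv R s ->
  continuous f ->
  (forall x : cube R n, exists2 l, l \in r & f x = affineZ l (val x)) ->
  (forall l m, l \in r -> m \in r -> sign_coherent (l.1 - m.1, l.2 - m.2) s) ->
  linear_on f s.
Proof.
move=> Is cf fr coh F WF; have FV := inv_faces_verts Is WF.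
have [->|[v0 v0F]] := fset_0Vmem F.
  exists (0, 0) => x /(hull_simplexP Is x (fsub0set _))[t [_]].
  by rewrite big_seq_fset0 => /esym/eqP; rewrite oner_eq0.
pose N : R := (#|` F|)%:R.
have N0 : 0 < N by rewrite ltr0n cardfs_gt0; apply/fset0Pn; exists v0.
pose b : nat -> R := fun v => if v \in F then N^-1 else 0.
pose x := \sum_(v <- F) b v *: rpt R (pt s v).
have bb v : v \in F -> b v = N^-1 by rewrite /b => ->.
have b1 : \sum_(v <- F) b v = 1.
  rewrite (eq_big_seq (fun=> N^-1)) // big_const_seq count_predT iter_addr_0.
  by rewrite -(mulr_natl _ (size F)) mulfV // gt_eqF.
have bx : barycentric s F b x.
  split=> //; split=> v; rewrite /b; last by move/negPf->.
  by case: ifP => // _; rewrite invr_ge0 ltW.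
have hx : hull R (simplex s F) x by apply/(hull_simplexP Is _ FV); exists b.
have cx := simplex_cube Is FV hx.
have [l lr fl] := fr (cube_pt cx).
exists l => y hy; have cy := simplex_cube Is FV hy.
have [t [[t0 _] t1 yE]] := (hull_simplexP Is _ FV).1 hy.
apply: (piece_propagates cf cx cy fr) => [m mr|]; last first.
  by rewrite (ext_in f cx) fl.
pose p := (m.1 - l.1, m.2 - l.2); pose q v := affineZ p (rpt R (pt s v)).
have px : affineZ m x - affineZ l x = \sum_(v <- F) N^-1 * q v.
  by rewrite -affineZB affineZ_sum //; apply: eq_big_seq => v /bb ->.
have py : affineZ m y - affineZ l y = \sum_(v <- F) t v * q v.
  by rewrite -affineZB yE affineZ_sum.
have Ni : 0 < N^-1 by rewrite invr_gt0.
have pairs v w : v \in F -> w \in F -> faces (cplx s) [fset v; w]%fset.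
  by move=> vF wF; apply: (inv_faces_sub Is WF); rewrite fsub2 vF.
have zero : \sum_(v <- F) N^-1 * q v = 0 ->
    (forall v, v \in F -> 0 <= q v) \/ (forall v, v \in F -> q v <= 0) ->
    \sum_(v <- F) t v * q v = 0.
  move=> /eqP; rewrite -mulr_sumr mulf_eq0 gt_eqF //= => s0 q0.
  have qz v : v \in F -> q v = 0.
    case: q0 => q0 vF.
      move: s0; rewrite big_seq psumr_eq0 // => /allP/(_ v vF).
      by rewrite vF => /eqP.
    move: s0; rewrite -oppr_eq0 -sumrN big_seq psumr_eq0.
      by move=> /allP/(_ v vF); rewrite vF oppr_eq0 => /eqP.
    by move=> w /q0; rewrite oppr_ge0.
  by rewrite big_seq big1 // => v /qz ->; rewrite mulr0.
have sgn := sign_coherent_vertices WF pairs (coh m l mr lr).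
have [e|ne] := eqVneq (affineZ m x - affineZ l x) (0 : R).
  apply: Or31; split; apply/eqP; rewrite -subr_eq0 ?e // py.
  by rewrite -px e in zero; rewrite zero.
case: sgn => q0; [apply: Or32|apply: Or33].
  rewrite -subr_gt0 lt0r ne px -[_ <= affineZ m y]subr_ge0 py big_seq.
  by split; [|rewrite big_seq]; apply: sumr_ge0 => v vF; apply: mulr_ge0 (q0 v vF);
    rewrite ?t0 // ltW.
rewrite -subr_lt0 lt_neqAle ne px -[_ <= affineZ l y]subr_le0 py big_seq.
by split; [|rewrite big_seq]; apply: sumr_le0 => v vF; apply: mulr_ge0_le0 (q0 v vF);
  rewrite ?t0 // ltW.
Qed.

End Linearity.

(** * Evaluation in the l-group *)

Section Evaluation.
Variables (R : realType) (n : nat) (G : unitalLGroupType).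
Implicit Types (s : state G n) (f g : plZ R n) (v w x : nat).
Local Notation inv := (@state_inv R G n).
Local Notation rpt := (rpt R).

(** The product is already an integer, the value of an integer form at [homog (pt s v)]; [Num.floor]
    only reads it as an [int]. *)
Definition vertex_coef f s v : int := Num.floor ((den (pt s v))%:R * ext f (rpt (pt s v))).

(* The image in [G] of [f], read off from the values of [f] at the vertices: in
   terms of the Schauder hats, [f] is [\sum_v den v * f v * hat v]. *)
Definition hat_eval s f : G := \sum_(v <- verts (cplx s)) hat s v *~ vertex_coef f s v.

Lemma vertex_coef_int f s v (z : int) :
  (den (pt s v))%:R * ext f (rpt (pt s v)) = z%:~R -> vertex_coef f s v = z.
Proof. by rewrite /vertex_coef => ->; apply: intrKfloor. Qed.

Lemma extB f g y : ext (f - g : plZ R n) y = ext f y - ext g y.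
Proof.
have [cy|ncy] := pselect (cube R n y); first by rewrite !(ext_in _ cy).
have none h : ext h y = 0 :> R.
  by rewrite /ext insubF //; apply/negbTE; apply/negP => /set_mem.
by rewrite !none subr0.
Qed.

Lemma ext_pos f y : ext (ljoin f 0 : plZ R n) y = Num.max (ext f y) 0.
Proof.
have [cy|ncy] := pselect (cube R n y); first by rewrite !(ext_in _ cy).
have none h : ext h y = 0 :> R.
  by rewrite /ext insubF //; apply/negbTE; apply/negP => /set_mem.
by rewrite !none maxxx.
Qed.

Section State.
Variables (s : state G n) (Is : inv s).
Local Notation V := (verts (cplx s)).

Lemma vertex_hull F v : faces (cplx s) F -> v \in F ->
  hull R (simplex s F) (rpt (pt s v)).
Proof.
move=> WF vF; apply/(hull_simplexP Is _ (inv_faces_verts Is WF)).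
exists (delta R v); split; first exact: supported_delta.
  by rewrite /delta (sum_fset_delta (fun=> 1)).
rewrite -[LHS](sum_fset_delta (fun v => rpt (pt s v)) vF).
by apply: eq_bigr => w _; rewrite /delta; case: eqP; rewrite ?scale1r ?scale0r.
Qed.

Lemma vertex_coef_linval f F l v : faces (cplx s) F -> v \in F ->
  (forall y, hull R (simplex s F) y -> ext f y = affineZ l y) ->
  vertex_coef f s v = linval l (homog (pt s v)).
Proof.
move=> WF vF lP; apply: vertex_coef_int.
by rewrite lP ?affineZ_homog //; apply: vertex_hull.
Qed.

Lemma vertex_coefE f v : linear_on f s -> v \in V ->
  (vertex_coef f s v)%:~R = (den (pt s v))%:R * ext f (rpt (pt s v)) :> R.
Proof.
move=> lin vV; have WF := inv_face1 Is vV; have [l lP] := lin _ WF.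
have vF : v \in [fset v]%fset by rewrite inE.
by rewrite (vertex_coef_linval WF vF lP) lP ?affineZ_homog //; apply: vertex_hull.
Qed.

Lemma hat_evalB f g : linear_on f s -> linear_on g s -> hat_eval s (f - g) = hat_eval s f - hat_eval s g.
Proof.
move=> lf lg; rewrite /hat_eval -sumrB; apply: eq_big_seq => v vV.
rewrite -mulrzBr; congr (_ *~ _); apply: vertex_coef_int.
by rewrite extB mulrBr intrB !vertex_coefE.
Qed.

Lemma vertex_coef_pos f v : linear_on f s -> v \in V ->
  vertex_coef (ljoin f 0 : plZ R n) s v = Num.max (vertex_coef f s v) 0.
Proof.
move=> lf vV; apply: vertex_coef_int; rewrite ext_pos.
by rewrite maxr_pMr // mulr0 -vertex_coefE // !maxEle lerz0; case: ifP.
Qed.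

(** If [f] changed sign on the edge, affinity of its positive part would give it the value [f v / 2]
    at the midpoint, whereas the positive part of [(f v + f w) / 2] is smaller. *)
Lemma linear_pos_coherent f v w : linear_on f s -> linear_on (ljoin f 0 : plZ R n) s ->
  faces (cplx s) [fset v; w]%fset -> 0 < vertex_coef f s v -> vertex_coef f s w < 0 -> False.
Proof.
move=> lf lp WF v0 w0; have FV := inv_faces_verts Is WF.
have /andP[vV wV] : (v \in V) && (w \in V) by rewrite -fsub2.
have vw : v != w by apply: contraTneq v0 => ->; rewrite -leNgt ltW.
have d0 x : 0 < (den (pt s x))%:R :> R by rewrite ltr0n den_gt0.
have fv : 0 < ext f (rpt (pt s v)) by rewrite -(pmulr_rgt0 _ (d0 v)) -vertex_coefE // ltr0z.
have fw : ext f (rpt (pt s w)) < 0 by rewrite -(pmulr_rlt0 _ (d0 w)) -vertex_coefE // ltrz0.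
have [[l lP] [m mP]] := (lf _ WF, lp _ WF).
pose z := 2^-1 *: rpt (pt s v) + 2^-1 *: rpt (pt s w).
have affz k : affineZ k z = 2^-1 * affineZ k (rpt (pt s v)) + 2^-1 * affineZ k (rpt (pt s w)).
  have h2 : 1 - 2^-1 = 2^-1 :> R by field.
  by have := affineZ_segment k (rpt (pt s v)) (rpt (pt s w)) 2^-1; rewrite h2.
have hv : hull R (simplex s [fset v; w]%fset) (rpt (pt s v)).
  by apply: vertex_hull; rewrite // !inE eqxx.
have hw : hull R (simplex s [fset v; w]%fset) (rpt (pt s w)).
  by apply: vertex_hull; rewrite // !inE eqxx orbT.
have hz : hull R (simplex s [fset v; w]%fset) z.
  apply/(hull_simplexP Is _ FV).
  have sum2 (U : zmodType) (h : nat -> U) : \sum_(x <- [fset v; w]%fset) h x = h v + h w.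
    by rewrite big_fsetU1 ?inE // big_seq_fset1.
  exists (fun x => if x \in [fset v; w]%fset then 2^-1 else 0); split.
  - split=> x; last by move/negPf->.
    by case: ifP => // _; rewrite invr_ge0.
  - by rewrite sum2 !inE !eqxx orbT /=; field.
  - by rewrite sum2 !inE !eqxx orbT /=.
have := mP z hz; rewrite affz -!mP // !ext_pos lP // affz -!lP //.
rewrite (max_idPl (ltW fv)) (max_idPr (ltW fw)) mulr0 addr0.
by case: leP => _; lra.
Qed.

(** Splitting the coefficients by sign writes [hat_eval s f] as a difference of nonnegative sums.
    Vertices with coefficients of opposite sign span no face, so their hats are disjoint by
    [inv_meet]; hence so are the two sums, and [ljoin_disjoint_sub] applies. *)
Lemma hat_eval_pos f : linear_on f s -> linear_on (ljoin f 0 : plZ R n) s ->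
  hat_eval s (ljoin f 0) = ljoin (hat_eval s f) 0.
Proof.
move=> lf lp; pose c v := vertex_coef f s v.
have pz v : exists k : nat, Num.max (c v) 0 = k%:Z.
  by exists `|Num.max (c v) 0|%N; rewrite gez0_abs // le_max lexx orbT.
have nz v : exists k : nat, Num.max (- c v) 0 = k%:Z.
  by exists `|Num.max (- c v) 0|%N; rewrite gez0_abs // le_max lexx orbT.
have p0 v : v \in V -> lle 0 (hat s v *~ Num.max (c v) 0).
  by move=> vV; have [k ->] := pz v; apply: lge0_mulrn; apply: inv_hat Is v vV.
have q0 v : v \in V -> lle 0 (hat s v *~ Num.max (- c v) 0).
  by move=> vV; have [k ->] := nz v; apply: lge0_mulrn; apply: inv_hat Is v vV.
transitivity (\sum_(v <- V) hat s v *~ Num.max (c v) 0).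
  by apply: eq_big_seq => v vV; rewrite vertex_coef_pos.
have -> : hat_eval s f = \sum_(v <- V) hat s v *~ Num.max (c v) 0
                   - \sum_(v <- V) hat s v *~ Num.max (- c v) 0.
  rewrite -sumrB; apply: eq_bigr => v _; rewrite -mulrzBr; congr (_ *~ _).
  by rewrite -/(c v); case: (leP (c v) 0) => h1; case: (leP (- c v) 0) => h2; lia.
rewrite ljoin_disjoint_sub //; [exact: lge0_sum|exact: lge0_sum|].
apply: disjoint_elts_sum => // v vV; apply: disjoint_eltsC.
apply: disjoint_elts_sum => // w wV.
have [cw0|cw0] := leP (c w) 0; first exact: disjoint_elts0.
have [cv0|cv0] := leP (- c v) 0; first by apply: disjoint_eltsC; apply: disjoint_elts0.
rewrite oppr_gt0 in cv0.
have hw := inv_hat Is wV; have hv := inv_hat Is vV.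
have -> : c w = `|c w|%N by rewrite gtz0_abs.
have -> : - c v = `|- c v|%N by rewrite gtz0_abs ?oppr_gt0.
apply: disjoint_elts_mulrn => //; apply: disjoint_eltsC; apply: disjoint_elts_mulrn => //.
move=> t t0 tw tv; apply: (@inv_meet _ _ _ _ Is [fset w; v]%fset) => //.
- by rewrite fsub2 wV.
- by move=> WF; apply: linear_pos_coherent lf lp WF cw0 cv0.
by move=> x; rewrite !inE => /orP[/eqP->|/eqP->].
Qed.

End State.

(** In a subdivision the coefficient at [a] is the sum of those at [v] and [w], so the hat [m] at
    [a] returns exactly what the other two hats have lost. In a deletion a vertex disappears only
    together with its zero hat. *)
Lemma step_hat_eval s s' f : inv s -> step s s' -> linear_on f s -> hat_eval s' f = hat_eval s f.
Proof.
move=> Is [//|v w a sub|M v [WM maxM] vM v0] lf; last first.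
  apply: big_fset_incl => [|x xV]; first exact: fsubset_verts_delete.
  rewrite mem_verts_delete xV /= negb_imply negbK => /andP[/cardfs1P[y My]].
  by move: vM; rewrite My !inE => /eqP <- /eqP->; rewrite v0 mul0rz.
have WF : faces (cplx s) [fset v; w]%fset by case: sub.
have [l lP] := lf _ WF.
have /andP[vV wV] : (v \in verts (cplx s)) && (w \in verts (cplx s)).
  by rewrite -fsub2; apply: inv_faces_verts Is _ WF.
have vw : v != w by case: sub.
have fresh x : x \in verts (cplx s) -> (x == a) = false by move=> xV; apply: (subdivisible_fresh sub xV).
have ca : vertex_coef f (sub_state s v w a) a = vertex_coef f s v + vertex_coef f s w.
  rewrite (vertex_coef_linval Is WF _ lP) ?inE ?eqxx // (vertex_coef_linval Is WF _ lP) ?inE ?eqxx ?orbT //.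
  apply: vertex_coef_int; rewrite pt_sub_new lP ?affineZ_homog ?(homog_new Is sub) ?linvalD //.
  by apply/(hull_mediant Is sub WF).
rewrite /hat_eval verts_subdivision big_fsetU1 ?(subdivisible_notin sub) //= ca /sub_hat eqxx.
set m := lmeet _ _; pose c x := vertex_coef f s x.
transitivity (m *~ (c v + c w) + \sum_(x <- verts (cplx s))
   (hat s x *~ c x - ((if x == v then m *~ c x else 0) + (if x == w then m *~ c x else 0)))).
  congr (_ + _); apply: eq_big_seq => x xV; rewrite fresh //.
  have -> : vertex_coef f (sub_state s v w a) x = c x by rewrite /vertex_coef (pt_sub_old sub).
  case: (eqVneq x v) => [->|_]; first by rewrite (negbTE vw) addr0 /= mulrzBl.
  by case: (eqVneq x w) => _ /=; rewrite add0r ?subr0 // mulrzBl.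
rewrite sumrB big_split /= !(sum_fset_delta (fun x => m *~ c x)) // -mulrzDr.
by rewrite addrCA subrr addr0.
Qed.

End Evaluation.

(** * The homomorphism read off at late stages, and its kernel *)

Section Limit.
Variables (R : realType) (n : nat) (G : unitalLGroupType).
Variable sigma : nat -> state G n.
Hypotheses (sigma_inv : forall j, state_inv R (sigma j))
  (sigma_step : forall j, step (sigma j) (sigma j.+1))
  (sigma_coherent : forall l, exists j, sign_coherent l (sigma j))
  (sigma_clean : forall k, exists2 j, (k <= j)%N & clean (sigma j))
  (sigma_unit : \sum_(v <- verts (cplx (sigma 0%N)))
     hat (sigma 0%N) v *+ den (pt (sigma 0%N) v) = ounit).
Implicit Types (f g : plZ R n).
Local Notation lin f j := (linear_on f (sigma j)).

Lemma coherent_later l i j : (i <= j)%N ->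
  sign_coherent l (sigma i) -> sign_coherent l (sigma j).
Proof.
elim: j => [|j IH]; first by rewrite leqn0 => /eqP ->.
rewrite leq_eqVlt => /predU1P[->//|]; rewrite ltnS => ij co.
exact: step_sign_coherent (sigma_inv j) (sigma_step j) (IH ij co).
Qed.

Lemma linear_later f i j : (i <= j)%N -> lin f i ->
  lin f j /\ hat_eval (sigma j) f = hat_eval (sigma i) f.
Proof.
elim: j => [|j IH]; first by rewrite leqn0 => /eqP ->.
rewrite leq_eqVlt => /predU1P[->//|]; rewrite ltnS => ij lf.
have [lj ej] := IH ij lf; split.
  exact: step_linear_on (sigma_inv j) (sigma_step j) lj.
by rewrite (step_hat_eval (sigma_inv j) (sigma_step j) lj).
Qed.

Lemma eventually_linear f : exists j, lin f j.
Proof.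
have [cf [r fr]] := plZP f.
pose ds : seq ('rV[int]_n * int) := [seq (l.1 - m.1, l.2 - m.2) | l <- r, m <- r].
have [j jP] : exists j, forall d, d \in ds -> sign_coherent d (sigma j).
  elim: ds => [|d ds [j jP]]; first by exists 0%N.
  have [i iP] := sigma_coherent d; exists (maxn i j) => d'.
  rewrite inE => /predU1P[->|/jP]; first exact: coherent_later (leq_maxl i j) iP.
  exact: coherent_later (leq_maxr i j).
exists j; apply: (sign_coherent_linear (sigma_inv j) cf fr) => l m lr mr.
by apply: jP; apply/allpairsP; exists (l, m).
Qed.

Definition stage f : nat := sval (cid (eventually_linear f)).

Lemma stage_linear f : lin f (stage f).
Proof. exact: svalP (cid (eventually_linear f)). Qed.
Arguments stage_linear : clear implicits.

Definition limit_eval f : G := hat_eval (sigma (stage f)) f.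

Lemma limit_evalE f j : lin f j -> limit_eval f = hat_eval (sigma j) f.
Proof.
move=> lf; rewrite /limit_eval.
have [_ <-] := linear_later (leq_maxl (stage f) j) (stage_linear f).
by have [_ <-] := linear_later (leq_maxr (stage f) j) lf.
Qed.

Lemma limit_evalB f g : limit_eval (f - g) = limit_eval f - limit_eval g.
Proof.
pose j := maxn (stage f) (maxn (stage g) (stage (f - g))).
have lf : lin f j by apply: (linear_later _ (stage_linear f)).1; rewrite leq_maxl.
have lg : lin g j.
  by apply: (linear_later _ (stage_linear g)).1; rewrite /j maxnCA leq_maxl.
have lfg : lin (f - g : plZ R n) j.
  by apply: (linear_later _ (stage_linear (f - g))).1; rewrite /j maxnA leq_maxr.
by rewrite (limit_evalE lf) (limit_evalE lg) (limit_evalE lfg) hat_evalB.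
Qed.

Lemma limit_eval0 : limit_eval 0 = 0.
Proof. by rewrite -(subrr (0 : plZ R n)) limit_evalB subrr. Qed.

Lemma limit_evalN f : limit_eval (- f) = - limit_eval f.
Proof. by rewrite -sub0r limit_evalB limit_eval0 sub0r. Qed.

Lemma limit_evalD f g : limit_eval (f + g) = limit_eval f + limit_eval g.
Proof. by rewrite -{1}[g]opprK limit_evalB limit_evalN opprK. Qed.

Lemma limit_eval_pos f : limit_eval (ljoin f 0) = ljoin (limit_eval f) 0.
Proof.
pose j := maxn (stage f) (stage (ljoin f 0)).
have lf : lin f j by apply: (linear_later _ (stage_linear f)).1; rewrite leq_maxl.
have lp : lin (ljoin f 0 : plZ R n) j.
  by apply: (linear_later _ (stage_linear (ljoin f 0))).1; rewrite leq_maxr.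
by rewrite (limit_evalE lf) (limit_evalE lp) (hat_eval_pos (sigma_inv j)).
Qed.

Lemma limit_eval_join f g :
  limit_eval (ljoin f g) = ljoin (limit_eval f) (limit_eval g).
Proof.
by rewrite [ljoin f g]ljoinE limit_evalD limit_eval_pos limit_evalB -ljoinE.
Qed.

Lemma limit_eval_meet f g :
  limit_eval (lmeet f g) = lmeet (limit_eval f) (limit_eval g).
Proof. by rewrite !lmeetE limit_evalN limit_eval_join !limit_evalN. Qed.

Lemma limit_eval_unit : limit_eval ounit = ounit.
Proof.
have one_pt v : v \in verts (cplx (sigma 0%N)) ->
    ext (ounit : plZ R n) (rpt R (pt (sigma 0%N) v)) = 1.
  move=> vV; have WF := inv_face1 (sigma_inv 0) vV.
  have vF : v \in [fset v]%fset by rewrite inE.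
  by rewrite (ext_in _ (simplex_cube (sigma_inv 0) (inv_faces_verts (sigma_inv 0) WF)
    (vertex_hull (sigma_inv 0) WF vF))).
have l1 : lin (ounit : plZ R n) 0.
  move=> F WF; exists (0, 1) => y hy.
  rewrite (ext_in _ (simplex_cube (sigma_inv 0) (inv_faces_verts (sigma_inv 0) WF) hy)).
  by rewrite /affineZ big1 ?add0r // => i _; rewrite mxE mul0r.
rewrite (limit_evalE l1) -sigma_unit; apply: eq_big_seq => v vV.
rewrite pmulrn; congr (_ *~ _); apply: (@vertex_coef_int R).
by rewrite one_pt // mulr1 -pmulrn.
Qed.

(** For the converse, the stage is clean and [f], its positive and its negative part are linear
    there. Each part evaluates to 0 as a sum of nonnegative terms, so all terms vanish; nonzero hats
    then force all coefficients of both parts to be 0. *)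
Lemma limit_eval_eq0 f : (exists j, forall x : cube R n,
    Defs.support R (real_complex (sigma j)) (val x) -> f x = 0) <-> limit_eval f = 0.
Proof.
have zero j g (x : cube R n) : lin g j ->
    (forall v, v \in verts (cplx (sigma j)) -> vertex_coef g (sigma j) v = 0) ->
    Defs.support R (real_complex (sigma j)) (val x) -> g x = 0.
  move=> lg c0 [_ [F WF <-] hx]; have [l lP] := lg F WF.
  have [t [_ t1 xE]] :=
    (hull_simplexP (sigma_inv j) _ (inv_faces_verts (sigma_inv j) WF)).1 hx.
  rewrite -extE lP // xE affineZ_sum // big_seq big1 // => v vF.
  have vV := fsubsetP (inv_faces_verts (sigma_inv j) WF) v vF.
  have -> : affineZ l (rpt R (pt (sigma j) v)) = 0.
    apply: (mulfI (denr_neq0 R (pt (sigma j) v))).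
    by rewrite affineZ_homog -(vertex_coef_linval (sigma_inv j) WF vF lP) c0 // mulr0.
  by rewrite mulr0.
split=> [[j fj]|f0].
  pose i := maxn j (stage f).
  have lf : lin f i by apply: (linear_later _ (stage_linear f)).1; rewrite leq_maxr.
  have sub k : (j <= k)%N -> Defs.support R (real_complex (sigma k)) `<=`
      Defs.support R (real_complex (sigma j)).
    elim: k => [|k IH]; first by rewrite leqn0 => /eqP ->.
    rewrite leq_eqVlt => /predU1P[->//|]; rewrite ltnS => /IH; apply: subset_trans.
    move=> x [_ [F WF <-] hx].
    have [S WS FS] := step_hull (sigma_inv k) (sigma_step k) WF.
    by exists (simplex (sigma k) S); [exists S|apply: FS].
  rewrite (limit_evalE lf) /hat_eval big_seq big1 // => v vV.
  have WF := inv_face1 (sigma_inv i) vV.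
  have vF : v \in [fset v]%fset by rewrite inE.
  have hv := vertex_hull (sigma_inv i) WF vF.
  have cv := simplex_cube (sigma_inv i) (inv_faces_verts (sigma_inv i) WF) hv.
  rewrite (@vertex_coef_int _ _ _ f (sigma i) v 0) ?mulr0z // (ext_in _ cv) fj ?mulr0 //.
  apply: (sub i (leq_maxl _ _)); exists (simplex (sigma i) [fset v]%fset) => //.
  by exists [fset v]%fset.
pose k := maxn (stage f) (maxn (stage (ljoin f 0)) (stage (ljoin (- f) 0))).
have [j kj cl] := sigma_clean k.
have lf : lin f j.
  by apply: (linear_later _ (stage_linear f)).1; apply: leq_trans kj; rewrite leq_maxl.
have lp : lin (ljoin f 0 : plZ R n) j.
  apply: (linear_later _ (stage_linear (ljoin f 0))).1; apply: leq_trans kj.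
  by rewrite /k maxnCA leq_maxl.
have lq : lin (ljoin (- f) 0 : plZ R n) j.
  apply: (linear_later _ (stage_linear (ljoin (- f) 0))).1; apply: leq_trans kj.
  by rewrite /k maxnA leq_maxr.
have key g : lin (ljoin g 0 : plZ R n) j -> limit_eval g = 0 ->
    forall v, v \in verts (cplx (sigma j)) -> vertex_coef (ljoin g 0 : plZ R n) (sigma j) v = 0.
  move=> lg g0 v vV; have Ij := sigma_inv j.
  have c_nat w : w \in verts (cplx (sigma j)) ->
      exists m : nat, vertex_coef (ljoin g 0 : plZ R n) (sigma j) w = m%:Z.
    move=> wV; exists (absz (vertex_coef (ljoin g 0 : plZ R n) (sigma j) w)).
    rewrite gez0_abs // -(ler0z R) (vertex_coefE Ij lg wV) mulr_ge0 // ext_pos.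
    by rewrite le_max lexx orbT.
  have := limit_eval_pos g; rewrite g0 ljoinxx (limit_evalE lg) => /lge0_sum_eq0.
  have [m cm] := c_nat v vV.
  move=> /(_ _ v vV); rewrite cm => h.
  case: m cm h => // m cm h; exfalso; apply: (cl v vV).
  apply: (@lge0_mulrn_eq0 _ _ m.+1) => //; first exact: inv_hat Ij v vV.
  apply: h => w wV; have [p ->] := c_nat w wV.
  by apply: lge0_mulrn; apply: inv_hat Ij w wV.
exists j => x; apply: (zero j f x lf) => v vV.
apply: (@vertex_coef_int R); rewrite mulr0z.
have := vertex_coefE (sigma_inv j) lp vV; rewrite (key f lp f0 v vV) ext_pos.
have := vertex_coefE (sigma_inv j) lq vV; rewrite (key (- f) lq _ v vV) ?limit_evalN ?f0 ?oppr0 //.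
rewrite ext_pos -[- f]sub0r extB.
have -> : ext (0 : plZ R n) (rpt R (pt (sigma j) v)) = 0.
  have WF := inv_face1 (sigma_inv j) vV.
  have vF : v \in [fset v]%fset by rewrite inE.
  by rewrite (ext_in _ (simplex_cube (sigma_inv j) (inv_faces_verts (sigma_inv j) WF)
    (vertex_hull (sigma_inv j) WF vF))).
move=> /esym/eqP; rewrite mulf_eq0 (negbTE (denr_neq0 R _)) /= sub0r => /eqP q0.
move=> /esym/eqP; rewrite mulf_eq0 (negbTE (denr_neq0 R _)) /= => /eqP p0.
set e := ext f _ in q0 p0 *.
have ge0 : - e <= 0 by rewrite -[leRHS]q0 le_max lexx.
have le0 : e <= 0 by rewrite -[leRHS]p0 le_max lexx.
have e0 : e = 0 by lra.
by rewrite e0 mulr0.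
Qed.

(** Coordinate functions are linear on the whole cube, hence evaluated at stage 0. Over the initial
    simplex they yield the elements of [h], which is the source of surjectivity. *)
Lemma limit_eval_coord (i : 'I_n) : exists f, limit_eval f =
  \sum_(v <- verts (cplx (sigma 0%N)))
    hat (sigma 0%N) v *~ homog (pt (sigma 0%N) v) 0 (lshift 1 i).
Proof.
pose l : 'rV[int]_n * int := (delta_mx 0 i, 0).
have lE (y : 'rV[R]_n) : affineZ l y = y 0 i.
  rewrite /affineZ addr0 (bigD1 i) //= big1 ?addr0 => [|j ji].
    by rewrite mxE !eqxx mul1r.
  by rewrite mxE eqxx (negbTE ji) mul0r.
have pl : piecewise_linearZ (fun x : cube R n => val x 0 i).
  split; last by exists [:: l] => x; exists l; rewrite ?mem_head ?lE.
  move=> x; apply: (@continuous_comp _ _ _ (val : cube R n -> _) (fun y : 'rV[R]_n => y 0 i)).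
    exact: initial_continuous.
  exact: coord_continuous.
exists (plZ_mk pl).
have extl F y : faces (cplx (sigma 0%N)) F -> hull R (simplex (sigma 0%N) F) y ->
    ext (plZ_mk pl) y = affineZ l y.
  move=> WF hy.
  by rewrite (ext_in _ (simplex_cube (sigma_inv 0) (inv_faces_verts (sigma_inv 0) WF) hy)) lE.
have ll : lin (plZ_mk pl) 0 by move=> F WF; exists l => y; apply: extl.
rewrite (limit_evalE ll); apply: eq_big_seq => v vV; congr (_ *~ _).
have WF := inv_face1 (sigma_inv 0) vV.
have vF : v \in [fset v]%fset by rewrite inE.
rewrite (vertex_coef_linval (sigma_inv 0) WF vF (fun y => extl _ y WF)).
rewrite /linval mul0r addr0 (bigD1 i) //= big1 ?addr0 => [|j ji].
  by rewrite mxE !eqxx mul1r.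
by rewrite mxE eqxx (negbTE ji) mul0r.
Qed.

Lemma limit_unital_liso (W : nat -> wcomplex nat) (r : realization_seq R n W) :
  (forall j, rs_complex r j = real_complex (sigma j)) ->
  (forall y, exists f, limit_eval f = y) ->
  unital_liso (Ggroup r) G.
Proof.
move=> rE surj.
have kerP f : f \in lideal_pred (orbit_ideal r) <-> limit_eval f = 0.
  rewrite -limit_eval_eq0; split=> [/orbit_idealP[j fj]|[j fj]].
    by exists j => x; rewrite -rE; apply: fj.
  by apply/orbit_idealP; exists j => x; rewrite rE; apply: fj.
(* Evaluation at a representative; its independence of the choice is the backward-compatible half of
   [kerP], applied to differences. *)
pose phi (q : Ggroup r) : G := limit_eval (repr q).
pose pr : plZ R n -> Ggroup r := \pi_(Quotient.quot (lideal_pred (orbit_ideal r))).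
have phiE f : phi (pr f) = limit_eval f.
  apply/eqP; rewrite -subr_eq0 -limit_evalB; apply/eqP/kerP.
  exact: lquot_repr.
have ind (P : Ggroup r -> Prop) : (forall f, P (pr f)) -> forall q, P q.
  exact: lquot_ind.
have prB f g : pr f - pr g = pr (f - g) by rewrite [RHS]raddfB.
have phiB : zmod_morphism phi.
  by elim/ind => f; elim/ind => g; rewrite prB !phiE limit_evalB.
pose phiA : {additive Ggroup r -> G} := HB.pack phi
  (GRing.isZmodMorphism.Build (Ggroup r) G phi phiB).
have phiAE f : phiA (pr f) = limit_eval f by exact: phiE.
exists phiA; split; first split.
- elim/ind => f; elim/ind => g.
  have -> : ljoin (pr f) (pr g) = pr (ljoin f g) by exact: lquot_pi_join.
  by rewrite !phiAE limit_eval_join.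
- elim/ind => f; elim/ind => g.
  have -> : lmeet (pr f) (pr g) = pr (lmeet f g) by exact: lquot_pi_meet.
  by rewrite !phiAE limit_eval_meet.
- by rewrite -limit_eval_unit -phiAE.
have /choice[h hE] := surj.
exists (fun y => pr (h y)) => [q|y]; last by rewrite phiAE.
elim/ind: q => f; apply/lquot_eqP/kerP; rewrite limit_evalB hE.
by rewrite phiAE subrr.
Qed.

End Limit.

(** * The initial simplex and the theorem *)

Section InitialState.
Variables (R : realType) (G : unitalLGroupType) (h : seq G).
Hypothesis h_nonneg : nonneg h.

Definition full_simplex N : wcomplex nat :=
  WComplex [fmap x : [fset x in iota 0 N]%fset => 1%N]%fmap
    [set F | (F `<=` [fset x in iota 0 N])%fset].

Local Notation W0 := (full_simplex (size h)).
Local Notation n := #|` verts W0|.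

Definition initial_state : state G n :=
  State W0 (canonical_map W0) (fun v => h`_v).

Local Notation s0 := initial_state.

Lemma mem_verts_full N v : (v \in verts (full_simplex N)) = (v < N)%N.
Proof. by rewrite !inE /= mem_iota. Qed.

Lemma weight_full v : v \in verts W0 -> weight W0 v = 1%N.
Proof. by move=> vV; rewrite /weight /= in_fnd ffunE. Qed.

Lemma canonical_full v i : v \in verts W0 ->
  canonical_map W0 v 0 i = ((i : nat) == index v (verts W0))%:R.
Proof. by move=> vV; rewrite mxE weight_full // invr1; case: eqP. Qed.

Lemma den_canonical_full v : v \in verts W0 -> den (canonical_map W0 v) = 1%N.
Proof.
move=> vV; apply/eqP; rewrite -dvdn1 den_dvd; apply/forallP => i.
by rewrite mul1r canonical_full // natr_int.
Qed.

Lemma homog_canonical_full v i : v \in verts W0 ->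
  homog (canonical_map W0 v) 0 (lshift 1 i) = ((i : nat) == index v (verts W0))%:R.
Proof.
move=> vV; apply: (@intr_inj rat).
by rewrite homog_lshift den_canonical_full // mul1r canonical_full //; case: eqP.
Qed.

Lemma index_verts v : v \in verts W0 -> (index v (verts W0) < n)%N.
Proof. by rewrite -index_mem. Qed.

Lemma sum_hat_index (V : zmodType) (t : nat -> V) v : v \in verts W0 ->
  \sum_(x <- verts W0) (if index v (verts W0) == index x (verts W0) then t x else 0) = t v.
Proof.
move=> vV; rewrite -(sum_fset_delta t vV); apply: eq_big_seq => x xV.
rewrite eq_sym; congr (if _ then _ else _); apply/eqP/eqP => [e|->//].
by rewrite -(nth_index 0%N xV) e nth_index.
Qed.

Lemma initial_inv : state_inv R s0.
Proof.
have FV F : faces W0 F -> (F `<=` verts W0)%fset by [].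
(* The condition on non-faces is vacuous here: every set of vertices is a face. *)
split=> //.
- split=> //.
  + move=> v; rewrite /= => vV; exists [fset v]%fset; last by rewrite inE.
    by rewrite /= fsub1set.
  + by move=> F E /= FW /fsubset_trans; apply.
  + by move=> v vV; rewrite weight_full.
(* One matrix serves all faces: its rows are the vectors [(e_i, 1)] of the vertices, all of weight
   1, and the last unit vector. *)
- move=> F WF; exists (block_mx 1%:M (const_mx 1) 0 1%:M).
    by rewrite unitmxE det_ublock !det1 mulr1 unitr1.
  move=> v vF; have vV := fsubsetP (FV _ WF) v vF.
  exists (lshift 1 (Ordinal (index_verts vV))); apply/rowP => i.
  rewrite mxE; case: (fintype.splitP i) => j ij.
    have -> : i = lshift 1 j by apply/val_inj.
    rewrite block_mxEul homog_canonical_full // mxE eq_sym.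
    by rewrite -(inj_eq val_inj).
  have -> : i = rshift n j by apply/val_inj.
  by rewrite block_mxEur mxE ord1 homog_last den_canonical_full.
- by move=> v vV; rewrite /= den_canonical_full // weight_full.
- move=> F S t u WF WS [_ tF] [_ uS] e v.
  have [vV|vV] := boolP (v \in verts W0); last first.
    by rewrite tF ?uS //; apply: contra vV; apply/fsubsetP.
  (* The first [n] homogeneous coordinates of a cone point are its coefficients. *)
  have coord (r : nat -> R) :
      cone_point s0 r 0 (lshift 1 (Ordinal (index_verts vV))) = r v.
    rewrite summxE -(sum_hat_index r vV); apply: eq_big_seq => x xV.
    rewrite [LHS]mxE [homogR _ _ _ _]mxE homog_canonical_full //.
    by case: eqP; rewrite ?mulr1 ?mulr0.
  by rewrite -coord e coord.
- move=> v vV i; rewrite /= canonical_full //.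
  by case: eqP; rewrite ?lexx ?ler01.
by move=> v vV; apply: h_nonneg; apply: mem_nth; rewrite -mem_verts_full.
Qed.

Lemma initial_unit : \sum_(y <- h) y = ounit ->
  \sum_(v <- verts (cplx s0)) hat s0 v *+ den (pt s0 v) = ounit.
Proof.
move=> <-; rewrite (eq_big_seq (fun v => h`_v)) => [|v vV]; last first.
  by rewrite /= den_canonical_full.
rewrite (perm_big (iota 0 (size h))) /=; last first.
  apply: uniq_perm; rewrite ?fset_uniq ?iota_uniq // => v.
  by rewrite mem_verts_full mem_iota.
by rewrite [RHS](big_nth 0) /index_iota subn0.
Qed.

Lemma initial_coord v (vV : v \in verts W0) :
  \sum_(x <- verts (cplx s0)) hat s0 x *~
    homog (pt s0 x) 0 (lshift 1 (Ordinal (index_verts vV))) = h`_v.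
Proof.
rewrite -(sum_hat_index (fun x => h`_x) vV); apply: eq_big_seq => x xV.
rewrite [pt s0 x]/(canonical_map W0 x) homog_canonical_full //=.
by case: eqP; rewrite ?mulr1z ?mulr0z.
Qed.

End InitialState.

Theorem theorem5p1 (R : realType) (G : unitalLGroupType) :
  finitely_generated G ->
  exists (W : nat -> wcomplex nat)
         (r : realization_seq R #|` verts (W 0%N)| W),
    [/\ stellar W, canonical_seq r & unital_liso (Ggroup r) G].
Proof.
move=> [gens gensP]; have [h [h0 [h_nonneg h_unit] h_span]] := partition_spanning gens.
pose s0 := initial_state h; pose n := #|` verts (cplx s0)|.
(* The integer affine forms are enumerated by [unpickle]. Every task also asks for a clean complex,
   and cleaning is done last, because subdivision can create zero hats while deletion preserves
   coherence. *)
pose task k (s : state G n) := clean s /\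
  (forall l : 'rV[int]_n * int, choice.unpickle k = Some l -> sign_coherent l s).
have taskP k s : state_inv R s -> can_reach (@step G n) (task k) s.
  move=> Is; rewrite /task; case: (choice.unpickle k) => [l|]; last first.
    have rc := @reach_clean R G n (@state_inv R G n) s (fun s2 q => q) (@step_inv R G n) Is.
    by apply: can_reach_trans rc _ => s2 [_ cl2]; apply: reach_now.
  pose Q (s1 : state G n) := state_inv R s1 /\ sign_coherent l s1.
  apply: can_reach_trans (reach_sign_coherent l Is) _ => s1 Q1.
  have Qstep s2 s3 : Q s2 -> step s2 s3 -> Q s3.
    move=> [I2 c2] st; split; first exact: step_inv I2 st.
    exact: step_sign_coherent I2 st c2.
  have rc := @reach_clean R G n Q s1 (fun s2 q => q.1) Qstep Q1.
  apply: can_reach_trans rc _ => s2 [[_ c2] cl2].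
  by apply: reach_now; split=> // _ [<-].
have I0 : state_inv R s0 := initial_inv R h_nonneg.
have [sigma' [sigma'0 sigma'_step sigma'_task]] := fair_sequence (@step_refl G n)
  (@step_inv R G n) taskP I0.
(* makes [sigma 0] convertible to [s0], on which the dimension depends *)
pose sigma j := if j is _.+1 then sigma' j else s0.
have sigmaE : sigma' = sigma by apply/funext => -[].
rewrite {}sigmaE in sigma'_step sigma'_task.
have sigma_inv j : state_inv R (sigma j).
  by elim: j => [//|j Ij]; apply: step_inv Ij (sigma'_step j).
have sigma_coherent (l : 'rV[int]_n * int) : exists j, sign_coherent l (sigma j).
  have [j _ [_]] := sigma'_task (choice.pickle l); rewrite choice.pickleK => /(_ l erefl) co.
  by exists j.
have sigma_clean k : exists2 j, (k <= j)%N & clean (sigma j).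
  by have [j kj [cl _]] := sigma'_task k; exists j.
have cube0 : Defs.support R (real_complex (sigma 0%N)) `<=` cube R n.
  move=> x [_ [F WF <-]]; apply: (simplex_cube (sigma_inv 0%N)).
  exact: inv_faces_verts (sigma_inv 0%N) _ WF.
pose r := @RealizationSeq R nat n (fun j => cplx (sigma j))
  (fun j => real_complex (sigma j)) (fun j => pt (sigma j))
  (fun j => inv_realization (sigma_inv j)) cube0
  (fun j => step_realization (sigma_inv j) (sigma'_step j)).
exists (fun j => cplx (sigma j)), r; split=> //.
  split=> [|j|j].
  - apply/fset0Pn; exists 0%N; rewrite mem_verts_full.
    by case: (h) h0.
  - exact: inv_wcomplex (sigma_inv j).
  case: (sigma'_step j) => [|v w a sub|M v maxM _ _].
  - exact: Or33.
  - by apply: Or32; exists v, w, a.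
  by apply: Or31; exists M.
pose ev := limit_eval sigma_inv sigma'_step sigma_coherent.
have h_ev y : y \in h -> exists f, ev f = y.
  move=> yh; have vV : index y h \in verts (cplx s0) by rewrite mem_verts_full index_mem.
  have [f fE] := limit_eval_coord sigma_inv sigma'_step sigma_coherent
    (Ordinal (index_verts vV)).
  by exists f; rewrite [LHS]fE [LHS](initial_coord vV) nth_index.
have unit0 := initial_unit h_unit.
apply: (@limit_unital_liso R n G sigma sigma_inv sigma'_step sigma_coherent sigma_clean
  unit0 _ r) => //.
(* The image is a unital l-subgroup; it contains [h], hence the integer span of [h] and the
   generators of [G], so it is all of [G]. *)
have ev_sub : unital_lsubgroup [set y | exists f, ev f = y].
  split.
  - by exists ounit; apply: limit_eval_unit.
  - by move=> _ _ [f <-] [g <-]; exists (f - g); apply: limit_evalB.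
  - by move=> _ _ [f <-] [g <-]; exists (ljoin f g); apply: limit_eval_join.
  - by move=> _ _ [f <-] [g <-]; exists (lmeet f g); apply: limit_eval_meet.
apply: (gensP _ ev_sub) => x /h_span[c ->] /=.
have ev_mulz y m : (exists f, ev f = y) -> exists f, ev f = y *~ m.
  move=> [f <-]; exists (f *~ m).
  have evN g : ev (- g) = - ev g by apply: limit_evalN.
  have evD g k : ev (g + k) = ev g + ev k by apply: limit_evalD.
  have evMn k : ev (f *+ k) = ev f *+ k.
    elim: k => [|k IH]; first by rewrite !mulr0n; apply: limit_eval0.
    by rewrite !mulrS evD IH.
  by case: m => k; rewrite ?NegzE ?mulrNz ?evN -!pmulrn evMn.
elim/big_rec: _ => [|i y _ [f fy]]; first by exists 0; apply: limit_eval0.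
have [g gE] := ev_mulz _ (c i) (h_ev _ (mem_nth 0 (ltn_ord i))).
by exists (g + f); rewrite -fy -gE; apply: limit_evalD.
Qed.
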